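(* Let $W$ be a finite Weyl group and fix a $2$-cocycle class $\alpha\in H^2(W,\mathbb C^* )$. There is an isomorphism of superalgebras $$\dot\Phi_+^{\alpha}:\ \mathcal C_{\mathfrak h^*}\rtimes_+\mathbb C W^{-\alpha}\ \xrightarrow{\ \simeq\ }\ \mathcal C_{\mathfrak h^*}\otimes\mathbb C W^{\alpha}$$ which extends the identity map on $\mathcal C_{\mathfrak h^*}$ and sends $t_i^+\mapsto-\sqrt{-1}\,\beta_it_i$ for each $i$. The inverse map $\dot\Psi_+^\alpha$ is the extension of the identity map on $\mathcal C_{\mathfrak h^*}$ which sends $t_i\mapsto\sqrt{-1}\,\beta_it_i^+$ for each $i$.
   Context: All algebras are over $\mathbb C$. A superalgebra is a $\mathbb Z_2$-graded algebra; tensor products of superalgebras have multiplication $(a\otimes b)(a'\otimes b')=(-1)^{|b||a'|}aa'\otimes bb'$. $W$ is a finite Weyl group (irreducible) with simple reflections $s_1,\dots,s_n$ and relations $(s_is_j)^{m_{ij}}=1$. $\mathfrak h$ is the reflection representation (in type $A_{n-1}$ take $\mathfrak h=\mathbb C^n$, the Cartan subalgebra of $gl_n$), with the standard $W$-invariant nondegenerate symmetric bilinear form $(-,-)$ on $\mathfrak h^*$. $\mathcal C_{\mathfrak h^*}$ is the Clifford algebra generated by $\mathfrak h^*$ with $ab+ba=(a,b)$; $W$ acts on it by automorphisms $a\mapsto a^w$. $\beta_i\in\mathfrak h^*$ is the simple root $\alpha_i$ rescaled by a positive scalar so that $\beta_i^2=1$, i.e. $(\beta_i,\beta_i)=2$.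 One has $H^2(W,\mathbb C^* )\cong\mathbb Z_2^k$ for some $k\in\{0,1,2,3\}$ (Ihara–Yokonuma); write $\alpha=(\alpha_1,\dots,\alpha_k)\in\{\pm1\}^k$ and $-\alpha=(-\alpha_1,\dots,-\alpha_k)$. The algebra $\mathbb C W^\alpha$ is generated by $t_1,\dots,t_n$ subject to $(t_it_j)^{m_{ij}}=1$ if $m_{ij}\in\{1,3\}$, and $(t_it_j)^{m_{ij}}=\alpha_{ij}$ if $m_{ij}\in\{2,4,6\}$, where $\alpha_{ij}=\alpha_{ji}\in\{\pm1\}$ is given as follows. - $A_n$ ($n\ge3$), $E_6,E_7,E_8$: $k=1$, $\alpha_{ij}=\alpha_1$ whenever $m_{ij}=2$. - $B_2$: $k=1$, $\alpha_{12}=\alpha_1$. - $B_3$: $k=2$, $\alpha_{13}=\alpha_1$, $\alpha_{23}=\alpha_2$. - $B_n$ ($n\ge4$): $k=3$, $\alpha_{ij}=\alpha_1$ for $i<j\le n-1$ with $m_{ij}=2$; $\alpha_{in}=\alpha_2$ for $i\le n-2$; $\alpha_{n-1,n}=\alpha_3$. - $D_4$ (node $2$ is the trivalent node): $k=3$, $\alpha_{13}=\alpha_1$, $\alpha_{14}=\alpha_2$, $\alpha_{34}=\alpha_3$. - $D_n$ ($n\ge5$; nodes $n-1$ and $n$ are both joined to $n-2$): $k=2$, $\alpha_{ij}=\alpha_1$ for $i<j$, $m_{ij}=2$, $i\ne n-1$; $\alpha_{n-1,n}=\alpha_2$. - $F_4$: $k=2$, $\alpha_{ij}=\alpha_1$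 whenever $m_{ij}=2$, $\alpha_{23}=\alpha_2$. - $G_2$: $k=1$, $\alpha_{12}=\alpha_1$. - $A_1,A_2$: $k=0$ and there are no even $m_{ij}$. This algebra is a twisted group algebra of $W$ of dimension $|W|$. $\mathcal C_{\mathfrak h^*}\rtimes_+\mathbb C W^{-\alpha}$ is the algebra generated by the subalgebras $\mathcal C_{\mathfrak h^*}$ and $\mathbb C W^{-\alpha}$ (as a vector space it is their tensor product), where the generators of $\mathbb C W^{-\alpha}$ are denoted $t_i^+$, with the additional relations $t_i^+a=a^{s_i}t_i^+$ for all $i$ and $a\in\mathfrak h^*$. Gradings: elements of $\mathfrak h^*$ are odd, the $t_i^+$ are even, and the $t_i\in\mathbb C W^\alpha$ are odd (so in $\mathcal C_{\mathfrak h^*}\otimes\mathbb C W^\alpha$ the $t_i$ anticommute with elements of $\mathfrak h^*$). *)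

(* Defs.v *)
From HB Require Import structures.
From mathcomp Require Import all_boot all_order all_algebra.
From mathcomp Require Import generic_quotient boolp reals complex.

Set Implicit Arguments.
Unset Strict Implicit.
Unset Printing Implicit Defensive.

Import Order.TTheory GRing.Theory Num.Theory.
Local Open Scope ring_scope.
Local Open Scope quotient_scope.

(* Superalgebras over K.  The grading A = A_0 (+) A_1 is carried by its
   homogeneous projections: A_p = { a | hpart p a = a }, with p = true for odd.
   This is not built on mathcomp's algType, which forces 1 != 0: an algebra
   given by generators and relations need not satisfy it. *)
Record superAlg (K : fieldType) := SuperAlg {
  sa_mod : lmodType K;
  sa_one : sa_mod;
  sa_mul : sa_mod -> sa_mod -> sa_mod;
  sa_mulA : associative sa_mul;
  sa_mul1l : left_id sa_one sa_mul;
  sa_mul1r : right_id sa_one sa_mul;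
  sa_mulDl : left_distributive sa_mul +%R;
  sa_mulDr : right_distributive sa_mul +%R;
  sa_scaleAl : forall (k : K) a b, k *: sa_mul a b = sa_mul (k *: a) b;
  sa_scaleAr : forall (k : K) a b, k *: sa_mul a b = sa_mul a (k *: b);
  sa_part : bool -> sa_mod -> sa_mod;
  sa_part_linear : forall p, linear (sa_part p);
  sa_part_sum : forall a, sa_part false a + sa_part true a = a;
  sa_partK : forall p q a,
    sa_part p (sa_part q a) = if p == q then sa_part q a else 0;
  sa_part_one : sa_part false sa_one = sa_one;
  sa_part_mul : forall p q a b,
    sa_part (p (+) q) (sa_mul (sa_part p a) (sa_part q b))
    = sa_mul (sa_part p a) (sa_part q b)
}.

Definition sa_sort (K : fieldType) (A : superAlg K) : Type := sa_mod A.
Coercion sa_sort : superAlg >-> Sortclass.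

HB.instance Definition _ (K : fieldType) (A : superAlg K) :=
  GRing.Lmodule.on (sa_sort A).
HB.instance Definition _ (K : fieldType) (A : superAlg K) :=
  GRing.Zmodule_isPzRing.Build (sa_sort A) (@sa_mulA K A) (@sa_mul1l K A)
    (@sa_mul1r K A) (@sa_mulDl K A) (@sa_mulDr K A).

Definition hpart (K : fieldType) (A : superAlg K) (p : bool) : A -> A :=
  @sa_part K A p.
HB.instance Definition _ (K : fieldType) (A : superAlg K) p :=
  GRing.isLinear.Build K A A *:%R (@hpart K A p) (@sa_part_linear K A p).

Definition homog (K : fieldType) (A : superAlg K) (p : bool) (a : A) : Prop :=
  hpart p a = a.

Record superHom (K : fieldType) (A B : superAlg K) := SuperHom {
  super_fun :> A -> B;
  super_linear : linear super_fun;
  super_monoid : monoid_morphism super_fun;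
  super_even : forall p a, homog p a -> homog p (super_fun a)
}.

Section SuperAlgebraTheory.
Variables (K : fieldType) (A : superAlg K).
Implicit Types (a b : A) (p q : bool).

Lemma superAl (k : K) a b : k *: (a * b) = (k *: a) * b.
Proof. exact: sa_scaleAl. Qed.

Lemma superAr (k : K) a b : k *: (a * b) = a * (k *: b).
Proof. exact: sa_scaleAr. Qed.

Lemma hpart_sum a : hpart false a + hpart true a = a.
Proof. exact: sa_part_sum. Qed.

Lemma hpartK p q a : hpart p (hpart q a) = if p == q then hpart q a else 0.
Proof. exact: sa_partK. Qed.

Lemma homog1 : homog false (1 : A).
Proof. exact: sa_part_one. Qed.

Lemma homogP p a : homog p (hpart p a).
Proof. by rewrite /homog hpartK eqxx. Qed.

Lemma homog_part p q a : homog p a -> hpart q a = if q == p then a else 0.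
Proof. by rewrite /homog => ha; rewrite -ha hpartK ha. Qed.

Lemma homogM p q a b : homog p a -> homog q b -> homog (p (+) q) (a * b).
Proof. by rewrite /homog => ha hb; rewrite -ha -hb; apply: sa_part_mul. Qed.

Lemma homogZ p k a : homog p a -> homog p (k *: a).
Proof. by rewrite /homog => ha; rewrite linearZ /= ha. Qed.

End SuperAlgebraTheory.

(* Algebras given by generators and relations: formal expressions in the
   generators modulo the least congruence that contains the relations and makes
   the quotient an associative unital K-algebra. *)
Inductive expr (K X : Type) :=
| EGen of X
| EZero
| EOne
| EAdd of expr K X & expr K X
| EMul of expr K X & expr K X
| EScale of K & expr K X.

Arguments EGen {K X}.
Arguments EZero {K X}.
Arguments EOne {K X}.

Declare Scope expr_scope.
Delimit Scope expr_scope with E.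
Bind Scope expr_scope with expr.
Notation "0" := EZero : expr_scope.
Notation "1" := EOne : expr_scope.
Notation "s + t" := (EAdd s t) : expr_scope.
Notation "s * t" := (EMul s t) : expr_scope.
Notation "k *: s" := (EScale k s) : expr_scope.
Notation "s ^+ n" := (iter n (EMul s) EOne) : expr_scope.

HB.instance Definition _ (K X : Type) := gen_eqMixin (expr K X).
HB.instance Definition _ (K X : Type) := gen_choiceMixin (expr K X).

Fixpoint emap (K X Y : Type) (f : X -> Y) (s : expr K X) : expr K Y :=
  match s with
  | EGen x => EGen (f x)
  | EZero => 0
  | EOne => 1
  | EAdd s t => emap f s + emap f t
  | EMul s t => emap f s * emap f t
  | EScale k s => k *: emap f s
  end%E.

Fixpoint ehomog (K X : Type) (par : X -> bool) (p : bool) (s : expr K X) : Prop :=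
  match s with
  | EGen x => par x = p
  | EZero => True
  | EOne => p = false
  | EAdd s t => ehomog par p s /\ ehomog par p t
  | EMul s t => exists q, ehomog par q s /\ ehomog par (p (+) q) t
  | EScale _ s => ehomog par p s
  end.

Record presentation (K : fieldType) := Presentation {
  gens : Type;
  gen_parity : gens -> bool;
  rels : expr K gens -> expr K gens -> Prop;
  rels_homog : forall s t, rels s t ->
    exists p, ehomog gen_parity p s /\ ehomog gen_parity p t
}.

Section Presented.
Variables (K : fieldType) (P : presentation K).
Local Notation E := (expr K (gens P)).

Inductive cong : E -> E -> Prop :=
| cong_rel s t : rels s t -> cong s t
| cong_refl s : cong s s
| cong_sym s t : cong s t -> cong t s
| cong_trans s t u : cong s t -> cong t u -> cong s u
| cong_add s s' t t' : cong s s' -> cong t t' -> cong (s + t) (s' + t')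
| cong_mul s s' t t' : cong s s' -> cong t t' -> cong (s * t) (s' * t')
| cong_scale k s s' : cong s s' -> cong (k *: s) (k *: s')
| cong_addA s t u : cong (s + (t + u)) (s + t + u)
| cong_addC s t : cong (s + t) (t + s)
| cong_add0 s : cong (0 + s) s
| cong_mulA s t u : cong (s * (t * u)) (s * t * u)
| cong_mul1l s : cong (1 * s) s
| cong_mul1r s : cong (s * 1) s
| cong_mulDl s t u : cong ((s + t) * u) (s * u + t * u)
| cong_mulDr s t u : cong (s * (t + u)) (s * t + s * u)
| cong_scale0 s : cong (0%R *: s) 0
| cong_scale1 s : cong (1%R *: s) s
| cong_scaleA k l s : cong (k *: (l *: s)) ((k * l)%R *: s)
| cong_scaleDr k s t : cong (k *: (s + t)) (k *: s + k *: t)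
| cong_scaleDl k l s : cong ((k + l)%R *: s) (k *: s + l *: s)
| cong_scaleAl k s t : cong (k *: (s * t)) ((k *: s) * t)
| cong_scaleAr k s t : cong (k *: (s * t)) (s * (k *: t)).

Definition congb : rel E := fun s t => `[< cong s t >].

Lemma congb_refl : reflexive congb.
Proof. by move=> s; apply/asboolP; apply: cong_refl. Qed.
Lemma congb_sym : symmetric congb.
Proof. by move=> s t; apply/asboolP/asboolP => /cong_sym. Qed.
Lemma congb_trans : transitive congb.
Proof.
by move=> t s u /asboolP h /asboolP h'; apply/asboolP; apply: cong_trans h'.
Qed.

Canonical congb_equiv := EquivRel congb congb_refl congb_sym congb_trans.

Definition presented : Type := {eq_quot congb_equiv}.
HB.instance Definition _ := Choice.on presented.

Definition pcls (s : E) : presented := \pi_{eq_quot congb_equiv} s.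

Lemma pclsP s t : cong s t <-> pcls s = pcls t.
Proof.
split=> [h|]; first by apply/eqmodP; apply/asboolP.
by move/(@eqmodP _ congb_equiv)/asboolP.
Qed.

Lemma pcls_eq s t : cong s t -> pcls s = pcls t.
Proof. by move/pclsP. Qed.

Definition prepr (x : presented) : E := repr (x : {eq_quot congb_equiv}).

Lemma preprK x : pcls (prepr x) = x.
Proof. exact: reprK. Qed.

Lemma cong_prepr s : cong (prepr (pcls s)) s.
Proof. by apply/pclsP; rewrite preprK. Qed.

Definition padd x y := pcls (prepr x + prepr y)%E.
Definition pmul x y := pcls (prepr x * prepr y)%E.
Definition pscale k x := pcls (k *: prepr x)%E.
Definition popp x := pscale (-1) x.

Let paddE s t : padd (pcls s) (pcls t) = pcls (s + t)%E.
Proof. by apply/pclsP/cong_add; apply: cong_prepr. Qed.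
Let pmulE s t : pmul (pcls s) (pcls t) = pcls (s * t)%E.
Proof. by apply/pclsP/cong_mul; apply: cong_prepr. Qed.
Let pscaleE k s : pscale k (pcls s) = pcls (k *: s)%E.
Proof. by apply/pclsP/cong_scale; apply: cong_prepr. Qed.

Lemma pcls_ind (Q : presented -> Prop) : (forall s, Q (pcls s)) -> forall x, Q x.
Proof. by move=> h x; rewrite -(preprK x). Qed.

Let paddA : associative padd.
Proof.
elim/pcls_ind=> s; elim/pcls_ind=> t; elim/pcls_ind=> u.
by rewrite !paddE; apply/pcls_eq/cong_addA.
Qed.
Let paddC : commutative padd.
Proof.
by elim/pcls_ind=> s; elim/pcls_ind=> t; rewrite !paddE; apply/pcls_eq/cong_addC.
Qed.
Let padd0 : left_id (pcls 0%E) padd.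
Proof. by elim/pcls_ind=> s; rewrite paddE; apply/pcls_eq/cong_add0. Qed.
Let paddN : left_inverse (pcls 0%E) popp padd.
Proof.
elim/pcls_ind=> s; rewrite /popp pscaleE paddE; apply/pcls_eq.
apply: (cong_trans _ (cong_scale0 s)).
have := cong_scaleDl (- (1 : K)) 1 s; rewrite addNr => h.
apply: cong_trans (cong_sym h).
by apply: cong_add; [apply: cong_refl | apply/cong_sym/cong_scale1].
Qed.

HB.instance Definition _ :=
  GRing.isZmodule.Build presented paddA paddC padd0 paddN.

Let pmulA : associative pmul.
Proof.
elim/pcls_ind=> s; elim/pcls_ind=> t; elim/pcls_ind=> u.
by rewrite !pmulE; apply/pcls_eq/cong_mulA.
Qed.
Let pmul1l : left_id (pcls 1%E) pmul.
Proof. by elim/pcls_ind=> s; rewrite pmulE; apply/pcls_eq/cong_mul1l. Qed.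
Let pmul1r : right_id (pcls 1%E) pmul.
Proof. by elim/pcls_ind=> s; rewrite pmulE; apply/pcls_eq/cong_mul1r. Qed.
Let pmulDl : left_distributive pmul +%R.
Proof.
elim/pcls_ind=> s; elim/pcls_ind=> t; elim/pcls_ind=> u.
rewrite [(_ + _)%R]paddE !pmulE [(_ + _)%R]paddE.
exact/pcls_eq/cong_mulDl.
Qed.
Let pmulDr : right_distributive pmul +%R.
Proof.
elim/pcls_ind=> s; elim/pcls_ind=> t; elim/pcls_ind=> u.
rewrite [(_ + _)%R]paddE !pmulE [(_ + _)%R]paddE.
exact/pcls_eq/cong_mulDr.
Qed.

HB.instance Definition _ := GRing.Zmodule_isPzRing.Build presented
  pmulA pmul1l pmul1r pmulDl pmulDr.

Let pscaleA k l x : pscale k (pscale l x) = pscale (k * l) x.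
Proof.
by elim/pcls_ind: x => s; rewrite !pscaleE; apply/pcls_eq/cong_scaleA.
Qed.
Let pscale1 : left_id 1 pscale.
Proof. by elim/pcls_ind=> s; rewrite pscaleE; apply/pcls_eq/cong_scale1. Qed.
Let pscaleDr : right_distributive pscale +%R.
Proof.
move=> k; elim/pcls_ind=> s; elim/pcls_ind=> t.
rewrite [(_ + _)%R]paddE !pscaleE [(_ + _)%R]paddE.
exact/pcls_eq/cong_scaleDr.
Qed.
Let pscaleDl x : {morph pscale^~ x : k l / k + l}.
Proof.
move=> k l; elim/pcls_ind: x => s.
by rewrite !pscaleE [RHS]paddE; apply/pcls_eq/cong_scaleDl.
Qed.

HB.instance Definition _ := GRing.Zmodule_isLmodule.Build K presented
  pscaleA pscale1 pscaleDr pscaleDl.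

Lemma pclsD s t : pcls (s + t)%E = pcls s + pcls t.
Proof. by rewrite [RHS]paddE. Qed.
Lemma pclsM s t : pcls (s * t)%E = pcls s * pcls t.
Proof. by rewrite [RHS]pmulE. Qed.
Lemma pclsZ k s : pcls (k *: s)%E = k *: pcls s.
Proof. by rewrite [RHS]pscaleE. Qed.
Lemma pcls0 : pcls 0%E = 0. Proof. by []. Qed.
Lemma pcls1 : pcls 1%E = 1. Proof. by []. Qed.
Definition pclsE := (pclsD, pclsM, pclsZ, pcls0, pcls1).

Let scalAl (k : K) (x y : presented) : k *: (x * y) = (k *: x) * y.
Proof.
elim/pcls_ind: x => s; elim/pcls_ind: y => t.
by rewrite -pclsM -!pclsZ -pclsM; apply/pcls_eq/cong_scaleAl.
Qed.
Let scalAr (k : K) (x y : presented) : k *: (x * y) = x * (k *: y).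
Proof.
elim/pcls_ind: x => s; elim/pcls_ind: y => t.
by rewrite -pclsM -!pclsZ -pclsM; apply/pcls_eq/cong_scaleAr.
Qed.

Fixpoint epart (p : bool) (s : E) : presented :=
  match s with
  | EGen x => if gen_parity x == p then pcls (EGen x) else 0
  | EZero => 0
  | EOne => if p then 0 else 1
  | EAdd s t => epart p s + epart p t
  | EMul s t => epart false s * epart p t + epart true s * epart (~~ p) t
  | EScale k s => k *: epart p s
  end.

Lemma epart_homog p q s : ehomog (@gen_parity K P) p s ->
  epart q s = if q == p then pcls s else 0.
Proof.
elim: s p q => [x|||s IHs t IHt|s IHs t IHt|k s IHs] p q /=.
- by move=> ->; rewrite eq_sym.
- by rewrite pcls0 if_same.
- by move=> ->; case: q.
- by move=> [/IHs-> /IHt->]; case: eqP; rewrite ?addr0 ?pclsE.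
- move=> [r [hs ht]]; rewrite !(IHs _ _ hs) !(IHt _ _ ht) !pclsE.
  by case: p q r {hs ht} => [] [] []; rewrite ?(mul0r, mulr0, add0r, addr0).
by move=> /IHs->; case: eqP; rewrite ?scaler0 ?pclsE.
Qed.

Lemma epart_cong p s t : cong s t -> epart p s = epart p t.
Proof.
move=> h; elim: h p => {s t}.
- move=> s t hr p; have [q [hs ht]] := rels_homog hr.
  by rewrite (epart_homog _ hs) (epart_homog _ ht) (pcls_eq (cong_rel hr)).
- by [].
- by move=> s t _ IH p; rewrite IH.
- by move=> s t u _ IH _ IH' p; rewrite IH IH'.
- by move=> s s' t t' _ IH _ IH' p /=; rewrite IH IH'.
- by move=> s s' t t' _ IH _ IH' p /=; rewrite !IH !IH'.
- by move=> k s s' _ IH p /=; rewrite IH.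
- by move=> s t u p /=; rewrite addrA.
- by move=> s t p /=; rewrite addrC.
- by move=> s p /=; rewrite add0r.
- move=> s t u p /=; rewrite negbK !(mulrDl, mulrDr) !mulrA.
  by rewrite -!addrA; congr (_ + _); rewrite [RHS]addrC -addrA.
- by move=> s p /=; rewrite mul1r mul0r addr0.
- by move=> s [] /=; rewrite mulr1 mulr0 ?addr0 ?add0r.
- by move=> s t u p /=; rewrite !mulrDl addrACA.
- by move=> s t u p /=; rewrite !mulrDr addrACA.
- by move=> s p /=; rewrite scale0r.
- by move=> s p /=; rewrite scale1r.
- by move=> k l s p /=; rewrite scalerA.
- by move=> k s t p /=; rewrite scalerDr.
- by move=> k l s p /=; rewrite scalerDl.
- by move=> k s t p /=; rewrite scalerDr !scalAl.
- by move=> k s t p /=; rewrite scalerDr !scalAr.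
Qed.

Definition phpart p (x : presented) := epart p (prepr x).

Lemma phpartE p s : phpart p (pcls s) = epart p s.
Proof. exact/epart_cong/cong_prepr. Qed.

Let phpart_linear p : linear (phpart p).
Proof.
move=> k; elim/pcls_ind=> s; elim/pcls_ind=> t.
by rewrite -pclsZ -pclsD !phpartE.
Qed.

Let phpart_sum x : phpart false x + phpart true x = x.
Proof.
elim/pcls_ind: x => s; rewrite !phpartE.
elim: s => [x|||s IHs t IHt|s IHs t IHt|k s IHs] /=; rewrite ?pclsE ?addr0 //.
- by case: gen_parity; rewrite ?add0r ?addr0.
- by rewrite addrACA IHs IHt.
- rewrite -IHs -IHt !(mulrDl, mulrDr) -!addrA; congr (_ + _).
  by rewrite addrC -addrA.
- by rewrite -scalerDr IHs.
Qed.

Let phpartM r x y :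
  phpart r (x * y) = phpart false x * phpart r y + phpart true x * phpart (~~ r) y.
Proof.
by elim/pcls_ind: x => s; elim/pcls_ind: y => t; rewrite -pclsM !phpartE.
Qed.

Let phpart_one : phpart false 1 = 1.
Proof. by rewrite -pcls1 phpartE. Qed.

Let phpartD p x y : phpart p (x + y) = phpart p x + phpart p y.
Proof. by have := phpart_linear p 1 x y; rewrite !scale1r. Qed.
Let phpart0 p : phpart p 0 = 0.
Proof. by rewrite -pcls0 phpartE. Qed.
Let phpartZ p k x : phpart p (k *: x) = k *: phpart p x.
Proof. by have := phpart_linear p k x 0; rewrite phpart0 !addr0. Qed.

Let phpartK p q x : phpart p (phpart q x) = if p == q then phpart q x else 0.
Proof.
elim/pcls_ind: x => s; rewrite !phpartE.
elim: s p q => [x|||s IHs t IHt|s IHs t IHt|k s IHs] p q /=.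
- case: eqP => [hx|_]; last by rewrite phpart0 if_same.
  by rewrite phpartE /= hx eq_sym.
- by rewrite phpart0 if_same.
- by case: p q => [] []; rewrite ?phpart0 // -pcls1 phpartE.
- by rewrite phpartD IHs IHt; case: eqP; rewrite ?addr0.
- rewrite phpartD !phpartM !IHs !IHt.
  by case: p q => [] [] /=; rewrite ?(mul0r, mulr0, add0r, addr0).
- by rewrite phpartZ IHs; case: eqP; rewrite ?scaler0.
Qed.

Let phpart_mul p q x y :
  phpart (p (+) q) (phpart p x * phpart q y) = phpart p x * phpart q y.
Proof.
rewrite phpartM !phpartK.
by case: p q => [] [] /=; rewrite ?(mul0r, mulr0, add0r, addr0).
Qed.

Definition presented_alg : superAlg K :=
  SuperAlg pmulA pmul1l pmul1r pmulDl pmulDr scalAl scalAr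
    phpart_linear phpart_sum phpartK phpart_one phpart_mul.

Definition cls (s : E) : presented_alg := pcls s.
Definition gen (x : gens P) : presented_alg := cls (EGen x).

Lemma clsD s t : cls (s + t)%E = cls s + cls t. Proof. exact: pclsD. Qed.
Lemma clsM s t : cls (s * t)%E = cls s * cls t. Proof. exact: pclsM. Qed.
Lemma clsZ k s : cls (k *: s)%E = k *: cls s. Proof. exact: pclsZ. Qed.
Lemma cls0 : cls 0%E = 0. Proof. by []. Qed.
Lemma cls1 : cls 1%E = 1. Proof. by []. Qed.

Lemma clsP s t : cong s t <-> cls s = cls t.
Proof. exact: pclsP. Qed.

Lemma cls_ind (Q : presented_alg -> Prop) : (forall s, Q (cls s)) -> forall x, Q x.
Proof. exact: pcls_ind. Qed.

Lemma cls_rel s t : rels s t -> cls s = cls t.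
Proof. by move=> h; apply/clsP/cong_rel. Qed.

Lemma hpart_cls p s : hpart p (cls s) = epart p s.
Proof. exact: phpartE. Qed.

End Presented.

Arguments gen {K P}.

(* The superalgebra morphism induced by a parity-preserving map of generators
   that carries relations to relations. *)
Section PresentedMap.
Variables (K : fieldType) (P Q : presentation K) (f : gens P -> gens Q).
Hypothesis fpar : forall x, gen_parity (f x) = gen_parity x.
Hypothesis frel : forall s t, rels s t -> rels (emap f s) (emap f t).

Let emap_cong s t : cong s t -> cong (emap f s) (emap f t).
Proof.
elim=> {s t} /=; try by econstructor; eauto.
Qed.

Definition pmap_fun (x : presented_alg P) : presented_alg Q :=
  cls (emap f (prepr x)).

Let pmapE s : pmap_fun (cls s) = cls (emap f s).
Proof. exact/pcls_eq/emap_cong/cong_prepr. Qed.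

Let pmap_linear : linear pmap_fun.
Proof.
move=> k; elim/cls_ind=> s; elim/cls_ind=> t.
by rewrite -clsZ -clsD !pmapE clsD clsZ.
Qed.

Let pmap_monoid : monoid_morphism pmap_fun.
Proof.
split; first by rewrite -cls1 pmapE.
by elim/cls_ind=> s; elim/cls_ind=> t; rewrite -clsM !pmapE clsM.
Qed.

Let pmap_part p x : hpart p (pmap_fun x) = pmap_fun (hpart p x).
Proof.
elim/cls_ind: x => s; rewrite pmapE !hpart_cls.
have pD x y : pmap_fun (x + y) = pmap_fun x + pmap_fun y.
  by have := pmap_linear 1 x y; rewrite !scale1r.
have p0 : pmap_fun 0 = 0 by rewrite -cls0 pmapE.
elim: s p => [x|||s IHs t IHt|s IHs t IHt|k s IHs] p /=.
- by rewrite fpar; case: eqP; rewrite ?p0 // pmapE.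
- by rewrite p0.
- by case: p; rewrite ?p0 // -cls1 pmapE.
- by rewrite IHs IHt -pD.
- by rewrite !IHs !IHt -!pmap_monoid.2 -pD.
- by have := pmap_linear k (epart p s) 0; rewrite p0 !addr0 IHs.
Qed.

Let pmap_even p x : homog p x -> homog p (pmap_fun x).
Proof. by rewrite /homog pmap_part => ->. Qed.

Definition presented_map : superHom (presented_alg P) (presented_alg Q) :=
  SuperHom pmap_linear pmap_monoid pmap_even.

Lemma presented_mapE s : presented_map (cls s) = cls (emap f s).
Proof. exact: pmapE. Qed.

End PresentedMap.

(* The tensor product of two vector spaces: formal sums of pure tensors modulo
   the vector space axioms and bilinearity. *)
Inductive texpr (K U V : Type) :=
| TPure of U & V
| TZero
| TAdd of texpr K U V & texpr K U V
| TScale of K & texpr K U V.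

Arguments TPure {K U V}.
Arguments TZero {K U V}.

HB.instance Definition _ (K U V : Type) := gen_eqMixin (texpr K U V).
HB.instance Definition _ (K U V : Type) := gen_choiceMixin (texpr K U V).

Definition bilinear_map (K : fieldType) (U V W : lmodType K) (f : U -> V -> W) :=
  (forall v, linear (f^~ v)) /\ (forall u, linear (f u)).

Section TensorSpace.
Variables (K : fieldType) (U V : lmodType K).
Local Notation T := (texpr K U V).

Inductive tcong : T -> T -> Prop :=
| tcong_refl s : tcong s s
| tcong_sym s t : tcong s t -> tcong t s
| tcong_trans s t u : tcong s t -> tcong t u -> tcong s u
| tcong_add s s' t t' : tcong s s' -> tcong t t' -> tcong (TAdd s t) (TAdd s' t')
| tcong_scale k s s' : tcong s s' -> tcong (TScale k s) (TScale k s')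
| tcong_addA s t u : tcong (TAdd s (TAdd t u)) (TAdd (TAdd s t) u)
| tcong_addC s t : tcong (TAdd s t) (TAdd t s)
| tcong_add0 s : tcong (TAdd TZero s) s
| tcong_scale0 s : tcong (TScale 0 s) TZero
| tcong_scale1 s : tcong (TScale 1 s) s
| tcong_scaleA k l s : tcong (TScale k (TScale l s)) (TScale (k * l) s)
| tcong_scaleDr k s t : tcong (TScale k (TAdd s t)) (TAdd (TScale k s) (TScale k t))
| tcong_scaleDl k l s : tcong (TScale (k + l) s) (TAdd (TScale k s) (TScale l s))
| tcong_pureDl u u' v : tcong (TPure (u + u') v) (TAdd (TPure u v) (TPure u' v))
| tcong_pureDr u v v' : tcong (TPure u (v + v')) (TAdd (TPure u v) (TPure u v'))
| tcong_pureZl k u v : tcong (TPure (k *: u) v) (TScale k (TPure u v))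
| tcong_pureZr k u v : tcong (TPure u (k *: v)) (TScale k (TPure u v)).

Definition tcongb : rel T := fun s t => `[< tcong s t >].

Lemma tcongb_refl : reflexive tcongb.
Proof. by move=> s; apply/asboolP; apply: tcong_refl. Qed.
Lemma tcongb_sym : symmetric tcongb.
Proof. by move=> s t; apply/asboolP/asboolP => /tcong_sym. Qed.
Lemma tcongb_trans : transitive tcongb.
Proof.
by move=> t s u /asboolP h /asboolP h'; apply/asboolP; apply: tcong_trans h'.
Qed.

Canonical tcongb_equiv := EquivRel tcongb tcongb_refl tcongb_sym tcongb_trans.

Definition tensor : Type := {eq_quot tcongb_equiv}.
HB.instance Definition _ := Choice.on tensor.

Definition tcls (s : T) : tensor := \pi_{eq_quot tcongb_equiv} s.
Definition trepr (x : tensor) : T := repr (x : {eq_quot tcongb_equiv}).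

Definition tens (u : U) (v : V) : tensor := tcls (TPure u v).

Let tclsP s t : tcong s t <-> tcls s = tcls t.
Proof.
split=> [h|]; first by apply/eqmodP; apply/asboolP.
by move/(@eqmodP _ tcongb_equiv)/asboolP.
Qed.

Let tcls_eq s t : tcong s t -> tcls s = tcls t.
Proof. by move/tclsP. Qed.

Let treprK x : tcls (trepr x) = x.
Proof. exact: reprK. Qed.

Let tcong_trepr s : tcong (trepr (tcls s)) s.
Proof. by apply/tclsP; rewrite treprK. Qed.

Definition tadd x y := tcls (TAdd (trepr x) (trepr y)).
Definition tscale k x := tcls (TScale k (trepr x)).
Definition topp x := tscale (-1) x.

Let taddE s t : tadd (tcls s) (tcls t) = tcls (TAdd s t).
Proof. by apply/tclsP/tcong_add; apply: tcong_trepr. Qed.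
Let tscaleE k s : tscale k (tcls s) = tcls (TScale k s).
Proof. by apply/tclsP/tcong_scale; apply: tcong_trepr. Qed.

Let tcls_ind (Q : tensor -> Prop) : (forall s, Q (tcls s)) -> forall x, Q x.
Proof. by move=> h x; rewrite -(treprK x). Qed.

Let taddA : associative tadd.
Proof.
elim/tcls_ind=> s; elim/tcls_ind=> t; elim/tcls_ind=> u.
by rewrite !taddE; apply/tcls_eq/tcong_addA.
Qed.
Let taddC : commutative tadd.
Proof.
by elim/tcls_ind=> s; elim/tcls_ind=> t; rewrite !taddE; apply/tcls_eq/tcong_addC.
Qed.
Let tadd0 : left_id (tcls TZero) tadd.
Proof. by elim/tcls_ind=> s; rewrite taddE; apply/tcls_eq/tcong_add0. Qed.
Let taddN : left_inverse (tcls TZero) topp tadd.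
Proof.
elim/tcls_ind=> s; rewrite /topp tscaleE taddE; apply/tcls_eq.
apply: (tcong_trans _ (tcong_scale0 s)).
have := tcong_scaleDl (- (1 : K)) 1 s; rewrite addNr => h.
apply: tcong_trans (tcong_sym h).
by apply: tcong_add; [apply: tcong_refl | apply/tcong_sym/tcong_scale1].
Qed.

HB.instance Definition _ :=
  GRing.isZmodule.Build tensor taddA taddC tadd0 taddN.

Let tscaleA k l x : tscale k (tscale l x) = tscale (k * l) x.
Proof.
by elim/tcls_ind: x => s; rewrite !tscaleE; apply/tcls_eq/tcong_scaleA.
Qed.
Let tscale1 : left_id 1 tscale.
Proof. by elim/tcls_ind=> s; rewrite tscaleE; apply/tcls_eq/tcong_scale1. Qed.
Let tscaleDr : right_distributive tscale +%R.
Proof.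
move=> k; elim/tcls_ind=> s; elim/tcls_ind=> t.
rewrite [(_ + _)%R]taddE !tscaleE [RHS]taddE.
exact/tcls_eq/tcong_scaleDr.
Qed.
Let tscaleDl x : {morph tscale^~ x : k l / k + l}.
Proof.
move=> k l; elim/tcls_ind: x => s.
by rewrite !tscaleE [RHS]taddE; apply/tcls_eq/tcong_scaleDl.
Qed.

HB.instance Definition _ := GRing.Zmodule_isLmodule.Build K tensor
  tscaleA tscale1 tscaleDr tscaleDl.

Lemma tensDl u u' v : tens (u + u') v = tens u v + tens u' v.
Proof. by rewrite [RHS]taddE; apply/tcls_eq/tcong_pureDl. Qed.
Lemma tensDr u v v' : tens u (v + v') = tens u v + tens u v'.
Proof. by rewrite [RHS]taddE; apply/tcls_eq/tcong_pureDr. Qed.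
Lemma tensZl k u v : tens (k *: u) v = k *: tens u v.
Proof. by rewrite [RHS]tscaleE; apply/tcls_eq/tcong_pureZl. Qed.
Lemma tensZr k u v : tens u (k *: v) = k *: tens u v.
Proof. by rewrite [RHS]tscaleE; apply/tcls_eq/tcong_pureZr. Qed.
Lemma tens0l v : tens 0 v = 0.
Proof. by rewrite -(scale0r (0 : U)) tensZl scale0r. Qed.
Lemma tens0r u : tens u 0 = 0.
Proof. by rewrite -(scale0r (0 : V)) tensZr scale0r. Qed.

Lemma tensor_ind (Q : tensor -> Prop) :
    (forall u v, Q (tens u v)) -> Q 0 -> (forall x y, Q x -> Q y -> Q (x + y)) ->
  forall x, Q x.
Proof.
move=> Qp Q0 Qa; elim/tcls_ind=> s.
have Qs : forall k, Q (tcls (TScale k s)).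
  elim: s => [u v||s IHs t IHt|l s IHs] k.
  - by rewrite -tscaleE [tscale _ _](esym (tensZl k u v)).
  - by rewrite -tscaleE -[tscale _ _]/(k *: (0 : tensor)) scaler0.
  - by rewrite (tcls_eq (tcong_scaleDr k s t)) -taddE; apply: Qa.
  - by rewrite (tcls_eq (tcong_scaleA k l s)).
by rewrite -(tcls_eq (tcong_scale1 s)).
Qed.

Section Lift.
Variables (W : lmodType K).
Implicit Types (f : U -> V -> W).

Fixpoint teval f (s : T) : W :=
  match s with
  | TPure u v => f u v
  | TZero => 0
  | TAdd s t => teval f s + teval f t
  | TScale k s => k *: teval f s
  end.

Definition tlift f (x : tensor) : W := teval f (trepr x).

Lemma tlift_comb k f g x :
  tlift (fun u v => k *: f u v + g u v) x = k *: tlift f x + tlift g x.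
Proof.
rewrite /tlift; elim: (trepr x) => [u v||s IHs t IHt|l s IHs] //=.
- by rewrite scaler0 addr0.
- by rewrite IHs IHt scalerDr addrACA.
- by rewrite IHs scalerDr !scalerA mulrC.
Qed.

Lemma eq_tlift f g x : (forall u v, f u v = g u v) -> tlift f x = tlift g x.
Proof.
move=> fg; rewrite /tlift; elim: (trepr x) => [u v||s IHs t IHt|l s IHs] //=.
- by rewrite IHs IHt.
- by rewrite IHs.
Qed.

Variable f : U -> V -> W.
Hypothesis bf : bilinear_map f.

Let fDl u u' v : f (u + u') v = f u v + f u' v.
Proof. by have := bf.1 v 1 u u'; rewrite !scale1r. Qed.
Let fDr u v v' : f u (v + v') = f u v + f u v'.
Proof. by have := bf.2 u 1 v v'; rewrite !scale1r. Qed.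
Let f0l v : f 0 v = 0.
Proof. by apply: (addrI (f 0 v)); rewrite -fDl !addr0. Qed.
Let f0r u : f u 0 = 0.
Proof. by apply: (addrI (f u 0)); rewrite -fDr !addr0. Qed.
Let fZl k u v : f (k *: u) v = k *: f u v.
Proof. by have := bf.1 v k u 0; rewrite f0l !addr0. Qed.
Let fZr k u v : f u (k *: v) = k *: f u v.
Proof. by have := bf.2 u k v 0; rewrite f0r !addr0. Qed.

Let teval_cong s t : tcong s t -> teval f s = teval f t.
Proof.
elim=> {s t} //=.
- by move=> s t u _ -> _ ->.
- by move=> s s' t t' _ -> _ ->.
- by move=> k s s' _ ->.
- by move=> s t u; rewrite addrA.
- by move=> s t; rewrite addrC.
- by move=> s; rewrite add0r.
- by move=> s; rewrite scale0r.
- by move=> s; rewrite scale1r.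
- by move=> k l s; rewrite scalerA.
- by move=> k s t; rewrite scalerDr.
- by move=> k l s; rewrite scalerDl.
Qed.

Let tliftP s : tlift f (tcls s) = teval f s.
Proof. exact/teval_cong/tcong_trepr. Qed.

Lemma tliftE u v : tlift f (tens u v) = f u v.
Proof. exact: tliftP. Qed.

Lemma tlift_linear : linear (tlift f).
Proof.
move=> k; elim/tcls_ind=> s; elim/tcls_ind=> t.
by rewrite [k *: _]tscaleE [X in tlift f X]taddE !tliftP.
Qed.

End Lift.

End TensorSpace.

(* The tensor product of superalgebras.  Extending the sign rule from
   homogeneous elements, the product of a (x) b and a' (x) b' sums
   (-1)^{pq} a a'_q (x) b_p b' over the homogeneous components of b and a'. *)
Section TensorAlgebra.
Variables (K : fieldType) (A B : superAlg K).
Local Notation T := (@tensor K (A : lmodType K) (B : lmodType K)).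

Definition tmul_pure (a : A) (b : B) (a' : A) (b' : B) : T :=
  \sum_p \sum_q (-1) ^+ (p && q) *: tens (a * hpart q a') (hpart p b * b').

Definition tmul (x y : T) : T :=
  tlift (fun a b => tlift (tmul_pure a b) y) x.

Definition tpart (r : bool) (x : T) : T :=
  tlift (fun a b => \sum_p tens (hpart p a) (hpart (p (+) r) b)) x.

Let bil1 a b : bilinear_map (tmul_pure a b).
Proof.
split=> [b'|a'] k x y; rewrite /tmul_pure scaler_sumr -big_split /=;
  apply: eq_bigr => p _; rewrite scaler_sumr -big_split /=;
  apply: eq_bigr => q _; rewrite scalerA [k * _]mulrC -scalerA -scalerDr;
  congr (_ *: _).
- by rewrite linearP /= mulrDr -superAr tensDl tensZl.
- by rewrite mulrDr -superAr tensDr tensZr.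
Qed.

Let bil2 y : bilinear_map (fun a b => tlift (tmul_pure a b) y).
Proof.
split=> [b|a] k x x'; rewrite -tlift_comb; apply: eq_tlift => a' b';
  rewrite /tmul_pure scaler_sumr -big_split /=;
  apply: eq_bigr => p _; rewrite scaler_sumr -big_split /=;
  apply: eq_bigr => q _; rewrite scalerA [k * _]mulrC -scalerA -scalerDr;
  congr (_ *: _).
- by rewrite mulrDl -superAl tensDl tensZl.
- by rewrite linearP /= mulrDl -superAl tensDr tensZr.
Qed.

Let bil3 r : bilinear_map
  (fun (a : A) (b : B) => \sum_p tens (hpart p a) (hpart (p (+) r) b) : T).
Proof.
split=> [b|a] k x x' /=; rewrite scaler_sumr -big_split /=; apply: eq_bigr => p _.
- by rewrite linearP /= tensDl tensZl.
- by rewrite linearP /= tensDr tensZr.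
Qed.

Let tmul_linear_l y : linear (tmul^~ y).
Proof. exact/tlift_linear/bil2. Qed.

Let tmul_linear_r x : linear (tmul x).
Proof.
move=> k y y'; rewrite /tmul -tlift_comb; apply: eq_tlift => a b.
exact/tlift_linear/bil1.
Qed.

Let tmulE a b a' b' : tmul (tens a b) (tens a' b') = tmul_pure a b a' b'.
Proof. by rewrite /tmul tliftE // tliftE. Qed.

Let tmulH a b a' b' p q : homog p b -> homog q a' ->
  tmul (tens a b) (tens a' b') = (-1) ^+ (p && q) *: tens (a * a') (b * b').
Proof.
move=> hb ha; rewrite tmulE /tmul_pure (bigD1 p) //= [X in _ + X]big1 ?addr0.
  rewrite (bigD1 q) //= [X in _ + X]big1 ?addr0 ?hb ?ha // => q' /negbTE q'q.
  by rewrite (homog_part _ ha) q'q mulr0 tens0l scaler0.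
move=> p' /negbTE p'p; apply: big1 => q' _.
by rewrite (homog_part _ hb) p'p mul0r tens0r scaler0.
Qed.

Let tens_hind (Q : T -> Prop) :
    (forall p q a b, homog p a -> homog q b -> Q (tens a b)) -> Q 0 ->
    (forall x y, Q x -> Q y -> Q (x + y)) ->
  forall x, Q x.
Proof.
move=> Qp Q0 Qa; apply: tensor_ind => // a b.
by rewrite -(hpart_sum a) -(hpart_sum b) !(tensDl, tensDr);
  do !apply: (Qa); apply: Qp; apply: homogP.
Qed.

Let tmulDl x x' y : tmul (x + x') y = tmul x y + tmul x' y.
Proof. by have := tmul_linear_l y 1 x x'; rewrite !scale1r. Qed.
Let tmulDr x y y' : tmul x (y + y') = tmul x y + tmul x y'.
Proof. by have := tmul_linear_r x 1 y y'; rewrite !scale1r. Qed.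
Let tmul0l y : tmul 0 y = 0.
Proof. by apply: (addrI (tmul 0 y)); rewrite -tmulDl !addr0. Qed.
Let tmul0r x : tmul x 0 = 0.
Proof. by apply: (addrI (tmul x 0)); rewrite -tmulDr !addr0. Qed.
Let tmulZl k x y : k *: tmul x y = tmul (k *: x) y.
Proof. by have := tmul_linear_l y k x 0; rewrite tmul0l !addr0. Qed.
Let tmulZr k x y : k *: tmul x y = tmul x (k *: y).
Proof. by have := tmul_linear_r x k y 0; rewrite tmul0r !addr0. Qed.

Let tmulA : associative tmul.
Proof.
apply: tens_hind => [p q a b ha hb||x x' hx hx'] y z; last 2 first.
- by rewrite !tmul0l.
- by rewrite !tmulDl hx hx'.
move: y z; apply: tens_hind => [p' q' a' b' ha' hb'||y y' hy hy'] z; last 2 first.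
- by rewrite tmul0l tmul0r tmul0l.
- by rewrite tmulDl tmulDr hy hy' tmulDr tmulDl.
move: z; apply: tens_hind => [p'' q'' a'' b'' ha'' hb''||z z' hz hz']; last 2 first.
- by rewrite !tmul0r.
- by rewrite !tmulDr hz hz'.
rewrite (tmulH a' b'' hb' ha'') (tmulH a b' hb ha') -tmulZr -tmulZl.
rewrite (tmulH _ _ hb (homogM ha' ha'')) (tmulH _ _ (homogM hb hb') ha'').
rewrite !scalerA !mulrA -!signr_addb; congr ((-1) ^+ _ *: _).
by clear; case: q q' p' p'' => [] [] [] [].
Qed.

Let tmul1l : left_id (tens (1 : A) (1 : B)) tmul.
Proof.
apply: tens_hind => [p q a b ha hb||x y hx hy]; last 2 first.
- by rewrite tmul0r.
- by rewrite tmulDr hx hy.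
by rewrite (tmulH _ _ (homog1 B) ha) scale1r !mul1r.
Qed.

Let tmul1r : right_id (tens (1 : A) (1 : B)) tmul.
Proof.
apply: tens_hind => [p q a b ha hb||x y hx hy]; last 2 first.
- by rewrite tmul0l.
- by rewrite tmulDl hx hy.
by rewrite (tmulH _ _ hb (homog1 A)) andbF scale1r !mulr1.
Qed.

Let tpart_linear r : linear (tpart r).
Proof. exact/tlift_linear/bil3. Qed.
Let tpartD r x y : tpart r (x + y) = tpart r x + tpart r y.
Proof. by have := tpart_linear r 1 x y; rewrite !scale1r. Qed.
Let tpart0 r : tpart r 0 = 0.
Proof. by apply: (addrI (tpart r 0)); rewrite -tpartD !addr0. Qed.
Let tpartZ r k x : tpart r (k *: x) = k *: tpart r x.
Proof. by have := tpart_linear r k x 0; rewrite tpart0 !addr0. Qed.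

Let tpartH r p q a b : homog p a -> homog q b ->
  tpart r (tens a b) = if r == p (+) q then tens a b else 0.
Proof.
move=> ha hb; rewrite /tpart tliftE // (bigD1 p) //= [X in _ + X]big1 ?addr0.
  rewrite ha (homog_part _ hb).
  by clear; case: p q r => [] [] []; rewrite ?tens0r.
by move=> p' /negbTE p'p; rewrite (homog_part _ ha) p'p tens0l.
Qed.

Let tpart_sum x : tpart false x + tpart true x = x.
Proof.
move: x; apply: tens_hind => [p q a b ha hb||x y hx hy]; last 2 first.
- by rewrite !tpart0 addr0.
- by rewrite !tpartD addrACA hx hy.
by rewrite !(tpartH _ ha hb); case: (p (+) q); rewrite ?add0r ?addr0.
Qed.

Let tpartK p q x : tpart p (tpart q x) = if p == q then tpart q x else 0.
Proof.
move: x; apply: tens_hind => [r s a b ha hb||x y hx hy]; last 2 first.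
- by rewrite !tpart0 if_same.
- by rewrite !tpartD hx hy; case: eqP; rewrite ?addr0.
rewrite (tpartH q ha hb); case: eqP => [->|_]; last by rewrite tpart0 if_same.
by rewrite (tpartH _ ha hb).
Qed.

Let tpart_one : tpart false (tens (1 : A) (1 : B)) = tens (1 : A) (1 : B).
Proof. by rewrite (tpartH _ (homog1 A) (homog1 B)). Qed.

Let tpart_mul p q x y :
  tpart (p (+) q) (tmul (tpart p x) (tpart q y)) = tmul (tpart p x) (tpart q y).
Proof.
move: x y; apply: tens_hind => [r s a b ha hb||x x' hx hx'] y; last 2 first.
- by rewrite tpart0 tmul0l tpart0.
- by rewrite tpartD tmulDl tpartD hx hx'.
move: y; apply: tens_hind => [r' s' a' b' ha' hb'||y y' hy hy']; last 2 first.
- by rewrite tpart0 tmul0r tpart0.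
- by rewrite tpartD tmulDr tpartD hy hy'.
rewrite (tpartH _ ha hb) (tpartH _ ha' hb').
case: eqP => [->|_]; last by rewrite tmul0l tpart0.
case: eqP => [->|_]; last by rewrite tmul0r tpart0.
rewrite (tmulH _ _ hb ha') tpartZ.
rewrite (tpartH _ (homogM ha ha') (homogM hb hb')).
by rewrite addbACA eqxx.
Qed.

Definition tensor_alg : superAlg K :=
  SuperAlg tmulA tmul1l tmul1r tmulDl tmulDr tmulZl tmulZr
    tpart_linear tpart_sum tpartK tpart_one tpart_mul.

Definition tensA (a : A) (b : B) : tensor_alg := tens a b.

Lemma tensA_mul a b a' b' p q : homog p b -> homog q a' ->
  tensA a b * tensA a' b' = (-1) ^+ (p && q) *: tensA (a * a') (b * b').
Proof. exact: tmulH. Qed.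

Lemma homog_tensA p q a b : homog p a -> homog q b -> homog (p (+) q) (tensA a b).
Proof. by move=> ha hb; rewrite /homog [LHS](tpartH _ ha hb) eqxx. Qed.

End TensorAlgebra.

(* Irreducible finite Weyl groups, by Cartan-Killing type. *)
Inductive weyl_type :=
  | TypeA of nat | TypeB of nat | TypeD of nat | TypeE of nat | TypeF4 | TypeG2.

Definition weyl_rank (W : weyl_type) : nat :=
  match W with
  | TypeA n | TypeB n | TypeD n | TypeE n => n
  | TypeF4 => 4
  | TypeG2 => 2
  end.

Definition irreducible_weyl (W : weyl_type) : bool :=
  match W with
  | TypeA n => 1 <= n
  | TypeB n => 2 <= n
  | TypeD n => 4 <= n
  | TypeE n => 6 <= n <= 8
  | TypeF4 | TypeG2 => true
  end%N.

(* Multiplicity of the bond between the nodes i < j of the Dynkin diagram, where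
   nodes are numbered from 1: in type B node n is the special end node, in type
   D nodes n-1 and n are both joined to n-2, type E is numbered as in Bourbaki
   (2 is joined to 4). *)
Definition dynkin (W : weyl_type) (i j : nat) : nat :=
  match W with
  | TypeA n => j == i.+1
  | TypeB n => if j == i.+1 then (if j == n then 2 else 1) else 0
  | TypeD n => (j == i.+1) && (j < n) || (j == i.+2) && (j == n)
  | TypeE n => [|| (i, j) == (1, 3), (i, j) == (2, 4) | (3 <= i) && (j == i.+1)]
  | TypeF4 => if j == i.+1 then (if i == 2 then 2 else 1) else 0
  | TypeG2 => 3
  end%N.

Section Weyl.
Variable W : weyl_type.
Local Notation n := (weyl_rank W).

Definition bond (i j : 'I_n) : nat := dynkin W (minn i j).+1 (maxn i j).+1.

Definition coxeter (i j : 'I_n) : nat :=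
  (if i == j then 1 else nth 0 [:: 2; 3; 4; 6] (bond i j))%N.

(* The squared length of the simple root numbered i (from 1). *)
Definition root_sqlen (i : nat) : nat :=
  match W with
  | TypeB n => if i == n then 1 else 2
  | TypeF4 => if i <= 2 then 2 else 1
  | TypeG2 => if i == 1 then 2 else 6
  | _ => 2
  end%N.

(* The k such that H^2(W, C^x) = Z_2^k. *)
Definition cocycle_rank : nat :=
  match W with
  | TypeA n => if 3 <= n then 1 else 0
  | TypeB n => if n == 2 then 1 else if n == 3 then 2 else 3
  | TypeD n => if n == 4 then 3 else 2
  | TypeE _ => 1
  | TypeF4 => 2
  | TypeG2 => 1
  end%N.

(* The l such that alpha_{ij} = alpha_l, for nodes i < j with m_{ij} even (nodes
   and l numbered from 1). *)
Definition cocycle_index (i j : nat) : nat :=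
  match W with
  | TypeA _ | TypeE _ | TypeG2 => 1
  | TypeB n =>
      if n == 2 then 1
      else if n == 3 then (if i == 1 then 1 else 2)
      else if j < n then 1 else if i == n.-1 then 3 else 2
  | TypeD n =>
      if n == 4 then (if i == 3 then 3 else if j == 4 then 2 else 1)
      else if i == n.-1 then 2 else 1
  | TypeF4 => if (i, j) == (2, 3) then 2 else 1
  end%N.

Lemma cocycle_index_bound (i j : 'I_n) : irreducible_weyl W -> ~~ odd (coxeter i j) ->
  (0 < cocycle_index (minn i j).+1 (maxn i j).+1 <= cocycle_rank)%N.
Proof.
move=> hW hm; have lti := ltn_ord i; have ltj := ltn_ord j; move: hm lti ltj.
rewrite /coxeter /bond -val_eqE /=; move: (i : nat) (j : nat) hW => {i j} i j.
rewrite /cocycle_index /cocycle_rank; case: W => [m|m|m|m||] //=; last first.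
- by move=> *; case: ifP.
- by move=> *; do !case: ifP.
- by move=> *; do !case: ifP.
move=> _ + lti ltj; case: ltnP => // m3; case: eqVneq => // neq.
case: eqP => //= nadj _; exfalso; apply: nadj.
by case: m m3 lti ltj => [|[|[|]]] //; case: i neq => [|[|i]]; case: j => [|[|j]].
Qed.

Section Cocycle.
Variables (K : numClosedFieldType) (alpha : 'rV[K]_cocycle_rank).

(* The default value 1 is never used when m_{ij} is even, see
   cocycle_index_bound. *)
Definition cocycle (i j : 'I_n) : K :=
  if insub (cocycle_index (minn i j).+1 (maxn i j).+1).-1 is Some l
  then alpha 0 l else 1.

End Cocycle.

(* The dual h^* of the reflection representation.  In type A_n it is the dual of
   the Cartan subalgebra of gl_(n+1), with its standard basis and form, and
   alpha_i = e_i - e_(i+1).  In the other types the basis is that of the simple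
   roots, and (alpha_i, alpha_j) = - max(|alpha_i|^2, |alpha_j|^2) / 2 for
   adjacent i and j. *)
Definition hdim : nat := if W is TypeA n then n.+1 else n.

Section Reflection.
Variable K : numClosedFieldType.
Local Notation V := 'rV[K]_hdim.

Definition gram (i j : nat) : K :=
  if W is TypeA _ then (i == j)%:R
  else if i == j then (root_sqlen i.+1)%:R
  else if dynkin W (minn i j).+1 (maxn i j).+1 == 0%N then 0
  else - ((maxn (root_sqlen i.+1) (root_sqlen j.+1))%:R / 2).

Definition form (u v : V) : K :=
  (u *m (\matrix_(i, j) gram i j) *m v^T) 0 0.

Definition simple_root (i : 'I_n) : V :=
  \row_j (if W is TypeA _ then (j == i :> nat)%:R - (j == i.+1 :> nat)%:R
          else (j == i :> nat)%:R).

(* a^{s_i} *)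
Definition simple_refl (i : 'I_n) (a : V) : V :=
  a - (2 * form a (simple_root i) / form (simple_root i) (simple_root i))
        *: simple_root i.

Definition beta (i : 'I_n) : V :=
  sqrtC (2 / form (simple_root i) (simple_root i)) *: simple_root i.

End Reflection.

End Weyl.

Section Algebras.
Variables (W : weyl_type) (K : numClosedFieldType).
Local Notation n := (weyl_rank W).
Local Notation V := 'rV[K]_(hdim W).

(* C_{h^*}: generated by the vector space h^*, with ab + ba = (a, b). *)
Inductive clifford_rel : expr K V -> expr K V -> Prop :=
| clifford_add a b : clifford_rel (EGen (a + b)) (EGen a + EGen b)
| clifford_scale k a : clifford_rel (EGen (k *: a)) (k *: EGen a)
| clifford_anticomm a b :
    clifford_rel (EGen a * EGen b + EGen b * EGen a) (form a b *: 1).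

Lemma clifford_homog s t : clifford_rel s t ->
  exists p, ehomog (fun _ => true) p s /\ ehomog (fun _ => true) p t.
Proof.
case=> [a b|k a|a b]; [by exists true | by exists true | exists false].
by split=> //; split; exists true.
Qed.

Definition clifford_pres : presentation K := Presentation clifford_homog.
Definition clifford : superAlg K := presented_alg clifford_pres.
Definition clifford_gen (a : V) : clifford := gen (a : gens clifford_pres).

Variable alpha : 'rV[K]_(cocycle_rank W).

(* The relations of C W^alpha. *)
Inductive twisted_rel : expr K 'I_n -> expr K 'I_n -> Prop :=
| twisted_odd i j : coxeter i j \in [:: 1; 3]%N ->
    twisted_rel ((EGen i * EGen j) ^+ coxeter i j) 1
| twisted_even i j : coxeter i j \in [:: 2; 4; 6]%N ->
    twisted_rel ((EGen i * EGen j) ^+ coxeter i j) (cocycle alpha i j *: 1).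

Lemma ehomog_exp (X : Type) (par : X -> bool) (s : expr K X) m :
  ehomog par false s -> ehomog par false (s ^+ m)%E.
Proof. by move=> hs; elim: m => //= m IH; exists false. Qed.

Lemma twisted_homog (p : bool) s t : twisted_rel s t ->
  exists q, ehomog (fun _ => p) q s /\ ehomog (fun _ => p) q t.
Proof.
have h i j m : ehomog (fun _ => p) false ((EGen i * EGen j : expr K 'I_n) ^+ m)%E.
  by apply: ehomog_exp; exists p; rewrite addFb.
by case=> i j _; exists false; split.
Qed.

(* C W^alpha with all t_i of parity p. *)
Definition twisted_pres (p : bool) : presentation K :=
  Presentation (@twisted_homog p).
Definition twisted (p : bool) : superAlg K := presented_alg (twisted_pres p).
Definition twisted_gen (p : bool) (i : 'I_n) : twisted p :=
  gen (i : gens (twisted_pres p)).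

(* C_{h^*} x|_+ C W^alpha: the generators and relations of the two algebras,
   together with t_i a = a^{s_i} t_i. *)
Inductive smash_rel : expr K (V + 'I_n) -> expr K (V + 'I_n) -> Prop :=
| smash_clifford s t : clifford_rel s t -> smash_rel (emap inl s) (emap inl t)
| smash_twisted s t : twisted_rel s t -> smash_rel (emap inr s) (emap inr t)
| smash_cross i a : smash_rel
    (EGen (inr i) * EGen (inl a)) (EGen (inl (simple_refl i a)) * EGen (inr i)).

Definition smash_parity (x : V + 'I_n) : bool := if x is inl _ then true else false.

Lemma ehomog_map (X Y : Type) (f : X -> Y) (par : Y -> bool) p (s : expr K X) :
  ehomog (par \o f) p s -> ehomog par p (emap f s).
Proof.
elim: s p => //= [s IHs t IHt|s IHs t IHt] p.
  by case=> /IHs ? /IHt.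
by case=> q [/IHs ? /IHt ?]; exists q.
Qed.

Lemma smash_homog s t : smash_rel s t ->
  exists p, ehomog smash_parity p s /\ ehomog smash_parity p t.
Proof.
case=> [{}s {}t /clifford_homog|{}s {}t /(twisted_homog false)|i a].
- by case=> p [hs ht]; exists p; split; apply: ehomog_map.
- by case=> p [hs ht]; exists p; split; apply: ehomog_map.
by exists true; split; [exists false | exists true].
Qed.

Definition smash_pres : presentation K := Presentation smash_homog.
Definition smash : superAlg K := presented_alg smash_pres.

Definition smash_incl_clifford : superHom clifford smash :=
  @presented_map K clifford_pres smash_pres inl (fun _ => erefl) smash_clifford.
Definition smash_incl_twisted : superHom (twisted false) smash :=
  @presented_map K (twisted_pres false) smash_pres inr (fun _ => erefl)
    smash_twisted.

(* The odd t_i of C W^alpha, and the even t_i^+ of C_{h^*} x|_+ C W^alpha. *)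
Definition t_odd (i : 'I_n) : twisted true := twisted_gen true i.
Definition t_plus (i : 'I_n) : smash := smash_incl_twisted (twisted_gen false i).

Definition clifford_tensor_twisted : superAlg K := tensor_alg clifford (twisted true).

End Algebras.

(* Main.v *)
Require Import Defs.
From HB Require Import structures.
From mathcomp Require Import all_boot all_order all_algebra.
From mathcomp Require Import boolp reals complex.
From mathcomp Require Import ring.

Set Implicit Arguments.
Unset Strict Implicit.
Unset Printing Implicit Defensive.

Import Order.TTheory GRing.Theory Num.Theory.
Local Open Scope ring_scope.

(** The isomorphism is a change of generators.  Let the Clifford algebra map
    to an algebra A, and let elements u_i of A anticommute with h^*.  Put
    w_i = - sqrt(-1) beta_i u_i.  Since beta_i^2 = 1, multiplying w_i by
    sqrt(-1) beta_i on the left gives back u_i, and since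
    beta_i a = - a^{s_i} beta_i, the new element satisfies w_i a = a^{s_i} w_i:
    it crosses vectors as the even generator t_i^+ does.  Moreover
    w_i w_j = (beta_i beta_j) (u_i u_j), with commuting factors, so
    (w_i w_j)^m = (beta_i beta_j)^m (u_i u_j)^m ([transfer_exp]).

    The sign change from alpha to - alpha comes from the factor
    (beta_i beta_j)^m with m = m_{ij}.  The element x = beta_i beta_j satisfies
    x^2 = c x - 1 with c = (beta_i, beta_j) = - 2 cos (pi / m), so it is a lift
    to the spin group of a rotation of order m, and x^m = (-1)^(m+1)
    ([clifford_rotation_order]).  Thus the odd relations are unchanged and the
    even ones change sign: the u_i satisfy the relations of C W^alpha exactly
    when the w_i satisfy those of C W^(-alpha) ([transfer_relations]).  Reading
    this equivalence from left to right in the tensor product, with u_i = t_i,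
    shows that Phi is well defined; reading it from right to left in the
    crossed product, with w_i = t_i^+, shows that Psi is.

    Phi then exists by the universal property of generators and relations
    ([presented_lift]), and Psi by that of the tensor product of superalgebras
    ([tensor_lift]), which asks for two morphisms with supercommuting images;
    supercommutation need only be tested on generators
    ([presented_supercomm]).  The two composites are the identity because they
    fix the generators. *)

(** * Morphisms of superalgebras *)

HB.instance Definition _ (K : fieldType) (A B : superAlg K)
    (f : superHom A B) :=
  GRing.isLinear.Build K A B *:%R (super_fun f) (super_linear f).
HB.instance Definition _ (K : fieldType) (A B : superAlg K)
    (f : superHom A B) :=
  GRing.isMonoidMorphism.Build A B (super_fun f) (super_monoid f).

Section SuperHomTheory.
Variable K : fieldType.

Lemma homogD (A : superAlg K) p (a b : A) :
  homog p a -> homog p b -> homog p (a + b).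
Proof. by rewrite /homog linearD /= => -> ->. Qed.

Lemma homog0 (A : superAlg K) p : homog p (0 : A).
Proof. exact: linear0. Qed.

Lemma superHomM (A B : superAlg K) (f : superHom A B) x y :
  f (x * y) = f x * f y.
Proof. exact: rmorphM. Qed.

Lemma superHomZ (A B : superAlg K) (f : superHom A B) k x :
  f (k *: x) = k *: f x.
Proof. exact: linearZ. Qed.

Definition superHom_id (A : superAlg K) : superHom A A :=
  SuperHom (fun _ _ _ => erefl) (conj erefl (fun _ _ => erefl))
    (fun _ _ ha => ha).

(** The three conditions are proved together in one opaque lemma, so that
    simplification does not unfold the morphism they define. *)
Lemma superHom_comp_proof (A B C : superAlg K) (g : superHom B C)
    (f : superHom A B) :
  [/\ linear (g \o f), monoid_morphism (g \o f)
    & forall p a, homog p a -> homog p (g (f a))].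
Proof.
split=> [k x y||p a ha]; first by rewrite /= !linearP.
  by split=> [|x y]; rewrite /= ?rmorph1 ?rmorphM.
by do 2!apply: super_even.
Qed.

Definition superHom_comp (A B C : superAlg K) (g : superHom B C)
    (f : superHom A B) : superHom A C :=
  let: And3 lin mon evn := superHom_comp_proof g f in SuperHom lin mon evn.

Lemma superHom_compE (A B C : superAlg K) (g : superHom B C)
    (f : superHom A B) a : superHom_comp g f a = g (f a).
Proof. by rewrite /superHom_comp; case: superHom_comp_proof. Qed.

End SuperHomTheory.

(** * The universal property of generators and relations *)

Section PresentedLift.
Variables (K : fieldType) (P : presentation K) (C : superAlg K).

Lemma presented_ext (f g : superHom (presented_alg P) C) :
  (forall x : gens P, f (gen x) = g (gen x)) -> f =1 g.
Proof.
move=> fg; elim/cls_ind; elim=> [x|||s IHs t IHt|s IHs t IHt|k s IHs].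
- exact: fg.
- by rewrite cls0 !linear0.
- by rewrite cls1 !rmorph1.
- by rewrite clsD !linearD /= IHs IHt.
- by rewrite clsM !rmorphM /= IHs IHt.
- by rewrite clsZ !linearZ /= IHs.
Qed.

Fixpoint eeval (X : Type) (f : X -> C) (s : expr K X) : C :=
  match s with
  | EGen x => f x
  | EZero => 0
  | EOne => 1
  | EAdd s t => eeval f s + eeval f t
  | EMul s t => eeval f s * eeval f t
  | EScale k s => k *: eeval f s
  end.

Lemma eeval_exp (X : Type) (f : X -> C) s m :
  eeval f (s ^+ m)%E = eeval f s ^+ m.
Proof. by elim: m => //= m ->; rewrite exprS. Qed.

Lemma eeval_emap (X Y : Type) (h : X -> Y) (f : Y -> C) s :
  eeval f (emap h s) = eeval (f \o h) s.
Proof.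
by elim: s => //= [s -> t ->|s -> t ->|k s ->].
Qed.

Variable f : gens P -> C.
Hypothesis fpar : forall x, homog (gen_parity x) (f x).
Hypothesis frel : forall s t, rels s t -> eeval f s = eeval f t.

Lemma eeval_cong s t : cong s t -> eeval f s = eeval f t.
Proof.
elim=> {s t} //=.
- by move=> s t u _ -> _ ->.
- by move=> s s' t t' _ -> _ ->.
- by move=> s s' t t' _ -> _ ->.
- by move=> k s s' _ ->.
- by move=> s t u; rewrite addrA.
- by move=> s t; rewrite addrC.
- by move=> s; rewrite add0r.
- by move=> s t u; rewrite mulrA.
- by move=> s; rewrite mul1r.
- by move=> s; rewrite mulr1.
- by move=> s t u; rewrite mulrDl.
- by move=> s t u; rewrite mulrDr.
- by move=> s; rewrite scale0r.
- by move=> s; rewrite scale1r.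
- by move=> k l s; rewrite scalerA.
- by move=> k s t; rewrite scalerDr.
- by move=> k l s; rewrite scalerDl.
- by move=> k s t; rewrite superAl.
- by move=> k s t; rewrite superAr.
Qed.

Definition lift_fun (x : presented_alg P) : C := eeval f (prepr x).

Lemma lift_cls s : lift_fun (cls s) = eeval f s.
Proof. exact/eeval_cong/cong_prepr. Qed.

Lemma lift_linear : linear lift_fun.
Proof.
move=> k; elim/cls_ind=> s; elim/cls_ind=> t.
by rewrite -clsZ -clsD !lift_cls.
Qed.

Lemma lift_monoid : monoid_morphism lift_fun.
Proof.
split; first by rewrite -cls1 lift_cls.
by elim/cls_ind=> s; elim/cls_ind=> t; rewrite -clsM !lift_cls.
Qed.

(** The homogeneous parts of a class are computed by recursion on an expression
    for it, so the lift preserves parity because it does so on generators. *)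
Lemma lift_epart p s : homog p (lift_fun (epart p s)).
Proof.
have lD x y : lift_fun (x + y) = lift_fun x + lift_fun y.
  by have := lift_linear 1 x y; rewrite !scale1r.
have l0 : lift_fun 0 = 0 by rewrite -cls0 lift_cls.
have lZ k x : lift_fun (k *: x) = k *: lift_fun x.
  by have := lift_linear k x 0; rewrite l0 !addr0.
have lM x y : lift_fun (x * y) = lift_fun x * lift_fun y.
  exact: (lift_monoid.2 x y).
elim: s p => [x|||s IHs t IHt|s IHs t IHt|k s IHs] p /=.
- case: eqP => [<-|_]; last by rewrite l0; apply: homog0.
  by rewrite [X in homog _ X]lift_cls; apply: fpar.
- by rewrite l0; apply: homog0.
- case: p; first by rewrite l0; apply: homog0.
  by rewrite [X in homog _ X](lift_monoid.1); apply: homog1.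
- by rewrite [X in homog _ X]lD; apply: homogD.
- rewrite [X in homog _ X]lD; apply: homogD.
    by rewrite [X in homog _ X]lM; apply: (homogM (IHs false) (IHt p)).
  rewrite [X in homog _ X]lM.
  by rewrite -{1}[p]negbK -[~~ ~~ p]addTb; apply: (homogM (IHs true)).
- by rewrite [X in homog _ X]lZ; apply: homogZ.
Qed.

Lemma lift_even p x : homog p x -> homog p (lift_fun x).
Proof.
by move=> <-; elim/cls_ind: x => s; rewrite hpart_cls; apply: lift_epart.
Qed.

Definition presented_lift : superHom (presented_alg P) C :=
  SuperHom lift_linear lift_monoid lift_even.

Lemma presented_lift_gen x : presented_lift (gen x) = f x.
Proof. exact: lift_cls. Qed.

End PresentedLift.

(** The elements of C that supercommute with v form a subsuperalgebra, so it
    suffices to test generators. *)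
Lemma presented_supercomm (K : fieldType) (P : presentation K)
    (C : superAlg K) (f : superHom (presented_alg P) C) (p : bool) (v : C) :
    (forall x : gens P,
       v * f (gen x) = (-1) ^+ (p && gen_parity x) *: (f (gen x) * v)) ->
  forall q y, homog q y -> v * f y = (-1) ^+ (p && q) *: (f y * v).
Proof.
move=> vgen q y <-; elim/cls_ind: y => s; rewrite hpart_cls.
elim: s q => [x|||s IHs t IHt|s IHs t IHt|k s IHs] q /=.
- case: eqP => [<-|_]; first exact: vgen.
  by rewrite !linear0 mulr0 mul0r scaler0.
- by rewrite !linear0 mulr0 mul0r scaler0.
- case: q; first by rewrite !linear0 mulr0 mul0r scaler0.
  by rewrite andbF scale1r [f _]rmorph1 mulr1 mul1r.
- by rewrite linearD /= mulrDr mulrDl scalerDr IHs IHt.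
- have mulE r r' : v * (f (epart r s) * f (epart r' t)) =
      (-1) ^+ (p && (r (+) r')) *: (f (epart r s) * f (epart r' t) * v).
    rewrite mulrA IHs -superAl -mulrA IHt -superAr scalerA mulrA.
    by rewrite -signr_addb andb_addr.
  rewrite linearD /= mulrDr mulrDl scalerDr.
  rewrite [f (_ * _)]rmorphM [f (epart true _ * _)]rmorphM !mulE /=.
  by rewrite negbK.
- by rewrite linearZ /= -superAr IHs -superAl !scalerA mulrC.
Qed.

Lemma eeval_gen (K : fieldType) (P : presentation K) (C : superAlg K)
    (f : superHom (presented_alg P) C) (s : expr K (gens P)) :
  eeval (fun x => f (gen x)) s = f (cls s).
Proof.
elim: s => [x|||s IHs t IHt|s IHs t IHt|k s IHs] /=.
- by [].
- by rewrite cls0 linear0.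
- by rewrite cls1 rmorph1.
- by rewrite clsD linearD /= IHs IHt.
- by rewrite clsM rmorphM /= IHs IHt.
- by rewrite clsZ linearZ /= IHs.
Qed.

(** * The universal property of the tensor product of superalgebras *)

Section TensorLift.
Variables (K : fieldType) (A B C : superAlg K).

Lemma tensA_ind (Q : tensor_alg A B -> Prop) :
    (forall p q a b, homog p a -> homog q b -> Q (tensA a b)) -> Q 0 ->
    (forall x y, Q x -> Q y -> Q (x + y)) ->
  forall x, Q x.
Proof.
move=> Qp Q0 Qa; apply: tensor_ind => // a b.
by rewrite -(hpart_sum a) -(hpart_sum b) !(tensDl, tensDr);
  do !apply: (Qa); apply: Qp; apply: homogP.
Qed.

Lemma incl_l_proof :
  [/\ linear (fun a : A => tensA a 1 : tensor_alg A B),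
      monoid_morphism (fun a : A => tensA a 1 : tensor_alg A B)
    & forall p a, homog p a -> homog p (tensA a 1 : tensor_alg A B)].
Proof.
split=> [k x y||p a ha]; first by rewrite /tensA tensDl tensZl.
  split=> // x y; rewrite -(hpart_sum y) mulrDr /tensA !tensDl mulrDr.
  rewrite !(tensA_mul _ _ (homog1 B) (homogP _ _)) /= !scale1r.
  by rewrite mulr1.
by rewrite -[p]addbF; apply: homog_tensA ha (homog1 B).
Qed.

Lemma incl_r_proof :
  [/\ linear (fun b : B => tensA 1 b : tensor_alg A B),
      monoid_morphism (fun b : B => tensA 1 b : tensor_alg A B)
    & forall p b, homog p b -> homog p (tensA 1 b : tensor_alg A B)].
Proof.
split=> [k x y||p b hb]; first by rewrite /tensA tensDr tensZr.
  split=> // x y; rewrite -(hpart_sum x) mulrDl /tensA !tensDr mulrDl.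
  rewrite !(tensA_mul _ _ (homogP _ _) (homog1 A)) !andbF /= !scale1r.
  by rewrite mulr1.
by rewrite -[p]addFb; apply: homog_tensA (homog1 A) hb.
Qed.

Definition incl_l : superHom A (tensor_alg A B) :=
  let: And3 lin mon evn := incl_l_proof in SuperHom lin mon evn.
Definition incl_r : superHom B (tensor_alg A B) :=
  let: And3 lin mon evn := incl_r_proof in SuperHom lin mon evn.

Lemma incl_lE a : incl_l a = tensA a 1.
Proof. by rewrite /incl_l; case: incl_l_proof. Qed.
Lemma incl_rE b : incl_r b = tensA 1 b.
Proof. by rewrite /incl_r; case: incl_r_proof. Qed.

Lemma incl_lrE a b : incl_l a * incl_r b = tensA a b.
Proof.
rewrite incl_lE incl_rE (tensA_mul _ _ (homog1 B) (homog1 A)) scale1r mulr1.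
by rewrite mul1r.
Qed.

(** The sign rule for the two factors; this is the universal instance of the
    hypothesis under which a pair of morphisms extends to the tensor product. *)
Lemma incl_rlE p q a b : homog p a -> homog q b ->
  incl_r b * incl_l a = (-1) ^+ (q && p) *: (incl_l a * incl_r b).
Proof.
move=> ha hb; rewrite incl_lrE incl_lE incl_rE (tensA_mul _ _ hb ha).
by rewrite mulr1 mul1r.
Qed.

Variables (f : superHom A C) (g : superHom B C).
Hypothesis fg : forall p q a b, homog p a -> homog q b ->
  g b * f a = (-1) ^+ (q && p) *: (f a * g b).

Definition tensor_lift_fun (x : tensor_alg A B) : C :=
  tlift (fun a b => f a * g b) x.

Let bil : bilinear_map (fun (a : A) (b : B) => f a * g b).
Proof.
split=> [b|a] k x y.
  by rewrite linearP /= mulrDl superAl.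
by rewrite linearP /= mulrDr superAr.
Qed.

Lemma tensor_lift_funE a b : tensor_lift_fun (tensA a b) = f a * g b.
Proof. exact: (tliftE bil). Qed.

Lemma tensor_lift_linear : linear tensor_lift_fun.
Proof. exact: tlift_linear. Qed.

Let lD x y : tensor_lift_fun (x + y) = tensor_lift_fun x + tensor_lift_fun y.
Proof. by have := tensor_lift_linear 1 x y; rewrite !scale1r. Qed.
Let l0 : tensor_lift_fun 0 = 0.
Proof. by apply: (addrI (tensor_lift_fun 0)); rewrite -lD !addr0. Qed.
Let lZ k x : tensor_lift_fun (k *: x) = k *: tensor_lift_fun x.
Proof. by have := tensor_lift_linear k x 0; rewrite l0 !addr0. Qed.

Lemma tensor_lift_monoid : monoid_morphism tensor_lift_fun.
Proof.
split; first by rewrite [LHS](tensor_lift_funE 1 1) !rmorph1 mulr1.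
apply: tensA_ind => [p q a b ha hb||x x' hx hx'] y; last 2 first.
- by rewrite mul0r l0 mul0r.
- by rewrite mulrDl !lD mulrDl hx hx'.
move: y; apply: tensA_ind => [p' q' a' b' ha' hb'||y y' hy hy']; last 2 first.
- by rewrite mulr0 l0 mulr0.
- by rewrite mulrDr !lD mulrDr hy hy'.
rewrite (tensA_mul _ _ hb ha') lZ !tensor_lift_funE !rmorphM /=.
rewrite -!mulrA [g b * (f a' * _)]mulrA (fg ha' hb).
by rewrite -superAl -superAr !mulrA.
Qed.

Lemma tensor_lift_even p x : homog p x -> homog p (tensor_lift_fun x).
Proof.
move=> <-; move: x; apply: tensA_ind => [q r a b ha hb||x y hx hy].
- rewrite (homog_part _ (homog_tensA ha hb)); case: eqP => [->|_].
    by rewrite tensor_lift_funE; apply: homogM; apply: super_even.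
  by rewrite l0; apply: homog0.
- by rewrite linear0 l0; apply: homog0.
- by rewrite linearD lD; apply: homogD.
Qed.

Definition tensor_lift : superHom (tensor_alg A B) C :=
  SuperHom tensor_lift_linear tensor_lift_monoid tensor_lift_even.

Lemma tensor_liftE a b : tensor_lift (tensA a b) = f a * g b.
Proof. exact: tensor_lift_funE. Qed.

End TensorLift.

Lemma tensor_ext (K : fieldType) (A B C : superAlg K)
    (f g : superHom (tensor_alg A B) C) :
  (forall a, f (tensA a 1) = g (tensA a 1)) ->
  (forall b, f (tensA 1 b) = g (tensA 1 b)) -> f =1 g.
Proof.
move=> fgl fgr; apply: tensA_ind => [p q a b _ _||x y hx hy].
- by rewrite -incl_lrE !rmorphM /= incl_lE incl_rE fgl fgr.
- by rewrite !linear0.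
- by rewrite !linearD /= hx hy.
Qed.

(** * The bilinear form on simple roots *)

(* The theory of sesquilinear forms also has a constant [form]. *)
Local Notation form := Defs.form.

Section RootForm.
Variables (W : weyl_type) (K : numClosedFieldType).
Local Notation V := 'rV[K]_(hdim W).

Lemma formE (u v : V) : form u v =
  \sum_(i < hdim W) \sum_(j < hdim W) u 0 i * gram W K i j * v 0 j.
Proof.
rewrite /form mxE exchange_big; apply: eq_bigr => j _ /=.
rewrite !mxE mulr_suml; apply: eq_bigr => i _.
by rewrite !mxE.
Qed.

Lemma gramC i j : gram W K i j = gram W K j i.
Proof.
rewrite /gram; case: W => [?|?|?|?||]; rewrite eq_sym // minnC maxnC;
  by rewrite (maxnC (root_sqlen _ _)); case: eqP => // ->.
Qed.

Lemma formC (u v : V) : form u v = form v u.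
Proof.
rewrite !formE exchange_big; apply: eq_bigr => j _; apply: eq_bigr => i _.
by rewrite gramC mulrC mulrA mulrAC.
Qed.

Lemma formZl k (u v : V) : form (k *: u) v = k * form u v.
Proof. by rewrite /form -!scalemxAl mxE. Qed.

Lemma formZr k (u v : V) : form u (k *: v) = k * form u v.
Proof. by rewrite formC formZl formC. Qed.

Lemma sum_delta m i (F : 'I_m -> K) (im : (i < m)%N) :
  \sum_(k < m) (k == i :> nat)%:R * F k = F (Ordinal im).
Proof.
rewrite (bigD1 (Ordinal im)) //= eqxx mul1r big1 ?addr0 // => k.
by rewrite -val_eqE /= => /negbTE->; rewrite mul0r.
Qed.

Lemma sum_delta_sub m i (F : 'I_m.+1 -> K) (im : (i < m)%N)
    (im' : (i < m.+1)%N) :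
  \sum_(k < m.+1) ((k == i :> nat)%:R - (k == i.+1 :> nat)%:R) * F k =
  F (Ordinal im') - F (Ordinal (im : (i.+1 < m.+1)%N)).
Proof.
under eq_bigr do rewrite mulrBl.
by rewrite sumrB sum_delta sum_delta.
Qed.

(** In type A the form is the standard one of gl_(n+1), in the other types it is
    given on simple roots; in both descriptions the simple roots have the same
    table of inner products. *)
Lemma form_simple_root (i j : 'I_(weyl_rank W)) :
  form (simple_root K i) (simple_root K j) =
    if i == j then (root_sqlen W i.+1)%:R
    else if bond i j == 0%N then 0
    else - ((maxn (root_sqlen W i.+1) (root_sqlen W j.+1))%:R / 2).
Proof.
rewrite formE; under eq_bigr => k _ do under eq_bigr => l _ do
  rewrite !mxE -mulrA [gram _ _ _ _ * _]mulrC.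
under eq_bigr => k _ do rewrite -mulr_sumr.
have := ltn_ord i; have := ltn_ord j; rewrite /bond -val_eqE /=.
move: (i : nat) (j : nat) => {i j} i j.
rewrite /gram; case: W => [n|n|n|n||] /= hj hi; last first.
1-5: by under eq_bigr => k _ do rewrite sum_delta; rewrite sum_delta.
under eq_bigr => k _ do rewrite (sum_delta_sub _ hj (ltnW hj)).
rewrite (sum_delta_sub _ hi (ltnW hi)) /= !eqSS.
have lt_neq a b : (a < b)%N -> (a == b.+1) = false.
  by move=> ab; apply/negbTE; rewrite neq_ltn ltnS (ltnW ab).
case: ltngtP => [ij|ji|->].
- rewrite (lt_neq _ _ ij) !mulr0n !subr0 sub0r eq_sym.
  by case: eqP => _; rewrite ?oppr0 // divff // pnatr_eq0.
- rewrite [_ == j](eq_sym _ j) (lt_neq _ _ ji) !mulr0n !subr0 sub0r.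
  by case: eqP => _; rewrite ?oppr0 // divff // pnatr_eq0.
by rewrite -[j.+1 == j]eq_sym ltn_eqF // !mulr0n !subr0 sub0r opprK.
Qed.

Lemma root_sqlen_gt0 i : (0 < root_sqlen W i)%N.
Proof. by rewrite /root_sqlen; case: W => *; do ?case: ifP. Qed.

Lemma form_beta_diag (i : 'I_(weyl_rank W)) : form (beta K i) (beta K i) = 2.
Proof.
rewrite /beta formZl formZr mulrA -expr2 sqrtCK form_simple_root eqxx.
by rewrite divfK // pnatr_eq0 -lt0n root_sqlen_gt0.
Qed.

(** The possible bonds together with the squared lengths of the two roots; for a
    multiple bond the shorter root comes first. *)
Variant bond_lengths : nat -> nat -> nat -> Prop :=
| BondLengths0 a b : bond_lengths 0 a b
| BondLengths1 a : bond_lengths 1 a a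
| BondLengths2 : bond_lengths 2 1 2
| BondLengths3 : bond_lengths 3 2 6.

Lemma bondC (i j : 'I_(weyl_rank W)) : bond i j = bond j i.
Proof. by rewrite /bond minnC maxnC. Qed.

Lemma coxeterC (i j : 'I_(weyl_rank W)) : coxeter i j = coxeter j i.
Proof. by rewrite /coxeter eq_sym bondC. Qed.

(** The value - 2 cos (pi / m) for each order m of a product of two distinct
    simple reflections; for m = 4 and 6 only its square matters. *)
Variant coxeter_form : nat -> K -> Prop :=
| CoxeterForm2 : coxeter_form 2 0
| CoxeterForm3 : coxeter_form 3 (-1)
| CoxeterForm4 c of c * c = 2 : coxeter_form 4 c
| CoxeterForm6 c of c * c = 3 : coxeter_form 6 c.

Hypothesis hW : irreducible_weyl W.

Lemma bondP (i j : 'I_(weyl_rank W)) : i != j ->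
  let s := root_sqlen W i.+1 in let t := root_sqlen W j.+1 in
  bond_lengths (bond i j) s t \/ bond_lengths (bond i j) t s.
Proof.
wlog ltij : i j / (i < j)%N.
  move=> IH ij; have [lt|lt|/val_inj eq] := ltngtP i j.
  - exact: IH.
  - by rewrite bondC; apply/or_comm/IH; rewrite 1?eq_sym.
  - by rewrite eq eqxx in ij.
move=> _ /=; rewrite /bond (minn_idPl (ltnW ltij)) (maxn_idPr (ltnW ltij)).
have ltj := ltn_ord j; move: ltij ltj hW.
move: (i : nat) (j : nat) => {i j} i j.
rewrite /root_sqlen; case: W => [n|n|n|n||] /= ltij ltjn hn.
- by case: eqP => _; left; constructor.
- case: eqP => [ji|_]; last by left; constructor.
  case: (j.+1 =P n) => [jn|_]; case: (i.+1 =P n) => [hi|_];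
    last by left; constructor.
  + by move: ltij; rewrite -ltnS hi jn ltnn.
  + by right; constructor.
  + by move: ltjn; rewrite -hi ltnS leqNgt ltij.
- by case: (_ || _); left; constructor.
- by case: (_ || _); left; constructor.
- by clear hn; case: i j ltij ltjn => [|[|[|[|i]]]] [|[|[|[|j]]]] //= _ _;
    [left|left|left|right|left|left]; constructor.
- by clear hn; case: i j ltij ltjn => [|[|i]] [|[|j]] //= _ _; left; constructor.
Qed.

Lemma form_beta (i j : 'I_(weyl_rank W)) : i != j ->
  coxeter_form (coxeter i j) (form (beta K i) (beta K j)).
Proof.
move=> ij.
wlog: i j ij / bond_lengths (bond i j) (root_sqlen W i.+1) (root_sqlen W j.+1).
  move=> IH; case: (bondP ij) => [|h]; first exact: IH.
  by rewrite coxeterC formC; apply: IH; rewrite 1?eq_sym 1?bondC.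
have n0 a : (0 < a)%N -> a%:R != 0 :> K by rewrite pnatr_eq0 lt0n.
have sq (k l x : K) :
    sqrtC k * (sqrtC l * x) * (sqrtC k * (sqrtC l * x)) = k * l * (x * x).
  by rewrite mulrACA -expr2 sqrtCK mulrACA -expr2 sqrtCK mulrA.
move=> h; rewrite /beta formZl formZr !form_simple_root !eqxx (negbTE ij).
rewrite /coxeter (negbTE ij).
have := root_sqlen_gt0 i.+1; case: h => [a b|a||] /= ha.
- by rewrite !mulr0; constructor.
- rewrite maxnn mulrA -expr2 sqrtCK mulrN mulrA divfK ?divff ?n0 //.
  by constructor.
- constructor; rewrite sq mulrNN divff ?n0 // !mulr1.
  by rewrite divr1.
- constructor; rewrite sq mulrNN divff ?n0 // mul1r.
  by rewrite -[6]/(2 * 3)%:R; field.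
Qed.
End RootForm.

(** * Products of two normalised roots in the Clifford algebra *)

Section CliffordTheory.
Variables (W : weyl_type) (K : numClosedFieldType).
Local Notation V := 'rV[K]_(hdim W).
Local Notation cl := (@clifford_gen W K).
Local Notation beta := (@beta W K).

Lemma clifford_genD (a b : V) : cl (a + b) = cl a + cl b.
Proof. by rewrite /clifford_gen -clsD; apply/cls_rel/clifford_add. Qed.

Lemma clifford_genZ k (a : V) : cl (k *: a) = k *: cl a.
Proof. by rewrite /clifford_gen -clsZ; apply/cls_rel/clifford_scale. Qed.

Lemma clifford_gen_anticomm (a b : V) :
  cl a * cl b + cl b * cl a = form a b *: (1 : clifford W K).
Proof.
rewrite /clifford_gen -!clsM -clsD -cls1 -clsZ.
exact/cls_rel/clifford_anticomm.
Qed.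

Lemma clifford_gen_homog (a : V) : homog true (cl a).
Proof. by rewrite /homog /clifford_gen hpart_cls. Qed.

Lemma clifford_betaK i : cl (beta i) * cl (beta i) = 1.
Proof.
have := clifford_gen_anticomm (beta i) (beta i).
rewrite form_beta_diag -mulr2n -scaler_nat => /(scalerI _); apply.
by rewrite pnatr_eq0.
Qed.

Lemma simple_reflE i (a : V) :
  simple_refl i a = a - form a (beta i) *: beta i.
Proof.
rewrite /simple_refl /beta formZr scalerA [sqrtC _ * _ * _]mulrAC.
by rewrite -expr2 sqrtCK [_ * form a _ / _]mulrAC.
Qed.

(** A unit vector of the Clifford algebra acts on vectors, by conjugation, as
    minus the reflection in it. *)
Lemma clifford_reflR i (a : V) :
  cl (beta i) * cl (simple_refl i a) = - (cl a * cl (beta i)).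
Proof.
rewrite simple_reflE clifford_genD -scaleNr (clifford_genZ _ (beta i)).
rewrite mulrDr -superAr.
rewrite clifford_betaK scaleNr -clifford_gen_anticomm opprD addrCA.
by rewrite subrr addr0.
Qed.

Lemma clifford_reflL i (a : V) :
  cl (simple_refl i a) * cl (beta i) = - (cl (beta i) * cl a).
Proof.
rewrite simple_reflE clifford_genD -scaleNr (clifford_genZ _ (beta i)).
rewrite mulrDl -superAl.
rewrite clifford_betaK scaleNr -clifford_gen_anticomm opprD addrA subrr.
by rewrite add0r.
Qed.

Hypothesis hW : irreducible_weyl W.

(** With x = beta_i beta_j and c = (beta_i, beta_j), the Clifford relation gives
    beta_j beta_i = c - x, hence x^2 = c x - 1.  Reducing powers of x by this
    equation gives x^3 = (c^2 - 1) x - c, and c^2 = 0, 1, 2, 3 for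
    m = 2, 3, 4, 6. *)
Lemma clifford_rotation_order (i j : 'I_(weyl_rank W)) :
  (cl (beta i) * cl (beta j)) ^+ coxeter i j = (-1) ^+ (coxeter i j).+1.
Proof.
have [->|ij] := eqVneq i j.
  by rewrite clifford_betaK /coxeter eqxx expr1n expr2 mulrNN mulr1.
set x := _ * _; have cP := form_beta K hW ij; set c := form _ _ in cP.
have x2 : x * x = c *: x - 1.
  have : cl (beta j) * cl (beta i) = c *: (1 : clifford W K) - x.
    by rewrite -clifford_gen_anticomm addrC addKr.
  rewrite /x mulrA -[_ * _ * cl (beta i)]mulrA => ->.
  rewrite mulrBr mulrBl -superAr mulr1 -superAl; congr (_ - _).
  by rewrite mulrA clifford_betaK mul1r clifford_betaK.
have x3 : x ^+ 3 = (c * c - 1) *: x - c *: (1 : clifford W K).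
  rewrite exprSr expr2 x2 mulrBl -superAl x2 mul1r scalerBr scalerA.
  by rewrite scalerBl scale1r addrAC.
move: x2 x3; clearbody c x; case: cP => [||{}c c2|{}c c3] x2 x3.
- by rewrite expr2 x2 scale0r sub0r -signr_odd expr1.
- rewrite x3 mulrNN mulr1 subrr scale0r sub0r scaleN1r opprK.
  by rewrite -signr_odd expr0.
- rewrite exprSr x3 c2 mulrBl -!superAl x2 mul1r.
  rewrite [2 - 1]addrK.
  by rewrite scale1r addrAC subrr sub0r -signr_odd expr1.
(* Here x^3 = 2 x - c, whose square is 4 x^2 - 4 c x + c^2 = c^2 - 4 = -1. *)
- have two : 3 - 1 = 2 :> K by apply: (addIr 1); rewrite subrK -natr1.
  rewrite (exprM x 3 2) x3 c3 two expr2 mulrBl -!superAl mul1r.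
  rewrite mulrBr -!superAr mulr1 x2 !scalerBr !scalerA c3.
  rewrite opprB addrACA -opprD -scalerDl addrAC [_ - _ - _]addrAC -scalerBl.
  rewrite -addrA [- _ + _]addrC -scalerBl -signr_odd expr1.
  have -> : 2 * 2 * c - (2 * c + c * 2) = 0 by ring.
  by have -> : 3 - 2 * 2 = -1 :> K by [ring]; rewrite scale0r add0r scaleN1r.
Qed.

End CliffordTheory.

(** * The relations of twisted group algebras *)

Section TwistedRelations.
Variables (W : weyl_type) (K : numClosedFieldType).
Hypothesis hW : irreducible_weyl W.
Implicit Types alpha : 'rV[K]_(cocycle_rank W).
Local Notation n := (weyl_rank W).

Lemma coxeter_cases (i j : 'I_n) : coxeter i j \in [:: 1; 2; 3; 4; 6]%N.
Proof.
have [->|ij] := eqVneq i j; first by rewrite /coxeter eqxx.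
by case: (form_beta K hW ij).
Qed.

Lemma cocycleN alpha (i j : 'I_n) : ~~ odd (coxeter i j) ->
  cocycle (- alpha) i j = - cocycle alpha i j.
Proof.
move=> hm; have /andP[l0 lk] := cocycle_index_bound hW hm.
by rewrite /cocycle insubT ?prednK // => lt; rewrite mxE.
Qed.

Definition braid_scalar alpha (i j : 'I_n) : K :=
  if odd (coxeter i j) then 1 else cocycle alpha i j.

Lemma braid_scalarN alpha (i j : 'I_n) :
  braid_scalar (- alpha) i j =
  (-1) ^+ (coxeter i j).+1 * braid_scalar alpha i j.
Proof.
rewrite /braid_scalar -signr_odd /=; case: ifP => [_|/negbT hm].
  by rewrite mulr1.
by rewrite cocycleN // mulN1r.
Qed.

(** Stated for a family in any superalgebra, so that the relations can be moved
    from one family to another without presentations. *)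
Definition twisted_relations (A : superAlg K) alpha (u : 'I_n -> A) :=
  forall i j, (u i * u j) ^+ coxeter i j = braid_scalar alpha i j *: (1 : A).

Lemma twisted_gen_relations alpha p (A : superAlg K)
    (g : superHom (twisted alpha p) A) :
  twisted_relations alpha (fun i => g (twisted_gen alpha p i)).
Proof.
set u := fun i => _; move=> i j.
have rel s t : twisted_rel alpha s t -> eeval u s = eeval u t.
  move=> st; rewrite !(@eeval_gen _ (twisted_pres alpha p) _ g).
  by congr (g _); apply: cls_rel.
have := coxeter_cases i j; rewrite !inE /braid_scalar.
have [odd_m|even_m] := boolP (odd (coxeter i j)) => hm.
  have := @rel _ _ (@twisted_odd W K alpha i j _).
  rewrite eeval_exp /= scale1r; apply; rewrite !inE.
  by move: hm odd_m; do 5!case: eqP => [->|_] //.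
have := @rel _ _ (@twisted_even W K alpha i j _).
rewrite eeval_exp /=; apply; rewrite !inE.
by move: hm even_m; do 5!case: eqP => [->|_] //.
Qed.

Section TwistedLift.
Variables (alpha : 'rV[K]_(cocycle_rank W)) (A : superAlg K) (u : 'I_n -> A).
Hypothesis u_rel : twisted_relations alpha u.

Lemma twisted_rel_eval s t : twisted_rel alpha s t -> eeval u s = eeval u t.
Proof.
case=> i j hm; rewrite eeval_exp /= u_rel /braid_scalar.
  by move: hm; rewrite !inE; do 2!case: eqP => [->|_] //; rewrite scale1r.
by move: hm; rewrite !inE; do 3!case: eqP => [->|_] //.
Qed.

Variable p : bool.
Hypothesis u_homog : forall i, homog p (u i).

Definition twisted_lift : superHom (twisted alpha p) A :=
  @presented_lift _ (twisted_pres alpha p) A u u_homog twisted_rel_eval.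

Lemma twisted_lift_gen i : twisted_lift (twisted_gen alpha p i) = u i.
Proof. exact: presented_lift_gen. Qed.
End TwistedLift.

(** The change of generators w_i = - sqrt(-1) beta_i u_i, for a family u_i that
    anticommutes with the image of h^*. *)
Section Transfer.
Variables (A : superAlg K) (b : superHom (clifford W K) A).
Variables (u w : 'I_n -> A).
Local Notation beta i := (b (clifford_gen (beta K i))).
Hypothesis u_anti : forall i a,
  u i * b (clifford_gen a) = - (b (clifford_gen a) * u i).
Hypothesis wE : forall i, w i = - 'i *: (beta i * u i).

(** Moving u_i past beta_j costs a sign, which cancels (- sqrt(-1))^2. *)
Lemma transfer_mul i j : w i * w j = beta i * beta j * (u i * u j).
Proof.
rewrite !wE -superAl -superAr scalerA mulrNN -expr2 sqrCi scaleN1r.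
by rewrite -!mulrA [u i * (_ * _)]mulrA u_anti mulNr !mulrN opprK !mulrA.
Qed.

Lemma transfer_exp i j m :
  (w i * w j) ^+ m = (beta i * beta j) ^+ m * (u i * u j) ^+ m.
Proof.
rewrite transfer_mul exprMn_comm // /GRing.comm.
have comm k : u i * u j * beta k = beta k * (u i * u j).
  by rewrite -mulrA u_anti mulrN [u i * (_ * _)]mulrA u_anti mulNr opprK mulrA.
by rewrite [RHS]mulrA comm -[RHS]mulrA comm [RHS]mulrA.
Qed.

(** The factor (beta_i beta_j)^m is the sign by which the scalars of - alpha
    differ from those of alpha.  As it is invertible, relations transfer both
    ways. *)
Lemma transfer_relations alpha :
  twisted_relations alpha u <-> twisted_relations (- alpha) w.
Proof.
have tr i j : (w i * w j) ^+ coxeter i j =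
    (-1) ^+ (coxeter i j).+1 *: (u i * u j) ^+ coxeter i j.
  rewrite transfer_exp -rmorphM -rmorphXn /= clifford_rotation_order //.
  rewrite rmorphXn rmorphN1; elim: (coxeter i j).+1 => [|m IH].
    by rewrite !expr0 mul1r scale1r.
  rewrite (exprS (-1 : A)) (exprS (-1 : K)) -mulrA IH mulN1r.
  by rewrite -scalerA scaleN1r.
split=> rel i j; first by rewrite tr rel scalerA -braid_scalarN.
have sgn_neq0 : (-1) ^+ (coxeter i j).+1 != 0 :> K by rewrite signr_eq0.
apply: (scalerI sgn_neq0).
by rewrite -tr rel scalerA -braid_scalarN.
Qed.
End Transfer.
End TwistedRelations.

(** * The two morphisms *)

Section Isomorphism.
Variables (W : weyl_type) (K : numClosedFieldType).
Hypothesis hW : irreducible_weyl W.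
Variable alpha : 'rV[K]_(cocycle_rank W).
Local Notation n := (weyl_rank W).
Local Notation V := 'rV[K]_(hdim W).
Local Notation S := (smash (- alpha)).
Local Notation T := (clifford_tensor_twisted alpha).
Local Notation iota := (smash_incl_clifford (- alpha)).
Local Notation inl_T := (incl_l (clifford W K) (twisted alpha true)).
Local Notation inr_T := (incl_r (clifford W K) (twisted alpha true)).
Local Notation cl := (@clifford_gen W K).
Local Notation beta := (@beta W K).

Definition phi_gen (x : V + 'I_n) : T :=
  match x with
  | inl a => inl_T (cl a)
  | inr i => - 'i *: (inl_T (cl (beta i)) * inr_T (t_odd alpha i))
  end.

Lemma t_odd_homog i : homog true (t_odd alpha i).
Proof. by rewrite /homog /t_odd /twisted_gen hpart_cls. Qed.

Lemma t_plus_homog i : homog false (t_plus (- alpha) i).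
Proof.
apply: super_even; by rewrite /homog /twisted_gen hpart_cls.
Qed.

Lemma t_odd_anti i a :
  inr_T (t_odd alpha i) * inl_T (cl a) =
  - (inl_T (cl a) * inr_T (t_odd alpha i)).
Proof.
by rewrite (incl_rlE (clifford_gen_homog a) (t_odd_homog i)) expr1 scaleN1r.
Qed.

Lemma phi_gen_homog x : homog (smash_parity x) (phi_gen x).
Proof.
case: x => [a|i] /=; first by apply/super_even/clifford_gen_homog.
apply: homogZ; apply: (@homogM _ _ true true); apply: super_even.
  exact: clifford_gen_homog.
exact: t_odd_homog.
Qed.

Lemma phi_gen_rel s t : smash_rel (- alpha) s t ->
  eeval phi_gen s = eeval phi_gen t.
Proof.
case=> [{}s {}t st|{}s {}t st|i a].
- rewrite !eeval_emap !(@eeval_gen _ (clifford_pres W K) _ inl_T).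
  by congr (inl_T _); apply: cls_rel.
- rewrite !eeval_emap; apply: twisted_rel_eval st.
  apply/(transfer_relations hW t_odd_anti) => //.
  exact: twisted_gen_relations.
- rewrite /= -superAl -superAr; congr (_ *: _).
  rewrite -mulrA t_odd_anti mulrN !mulrA -!rmorphM /=.
  by rewrite clifford_reflL rmorphN mulNr.
Qed.

Definition Phi : superHom S T :=
  @presented_lift _ (smash_pres (- alpha)) T phi_gen phi_gen_homog phi_gen_rel.

Lemma iota_cl a : iota (cl a) = gen (inl a : gens (smash_pres (- alpha))).
Proof.
exact: (@presented_mapE _ (clifford_pres W K) (smash_pres (- alpha))).
Qed.

Lemma Phi_gen (x : V + 'I_n) :
  Phi (gen (x : gens (smash_pres (- alpha)))) = phi_gen x.
Proof. exact: (@presented_lift_gen _ (smash_pres (- alpha))). Qed.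

Lemma t_plusE i :
  t_plus (- alpha) i = gen (inr i : gens (smash_pres (- alpha))).
Proof.
exact: (@presented_mapE _ (twisted_pres (- alpha) false)
  (smash_pres (- alpha))).
Qed.

Lemma Phi_iota c : Phi (iota c) = inl_T c.
Proof.
rewrite -superHom_compE; move: c; apply: presented_ext => a.
by rewrite superHom_compE [iota _](iota_cl a) Phi_gen.
Qed.

Lemma Phi_t_plus i :
  Phi (t_plus (- alpha) i) =
  - 'i *: (inl_T (cl (beta i)) * inr_T (t_odd alpha i)).
Proof. by rewrite t_plusE Phi_gen. Qed.

Definition psi_gen (i : 'I_n) : S :=
  'i *: (iota (cl (beta i)) * t_plus (- alpha) i).

Lemma t_plus_cross i a :
  t_plus (- alpha) i * iota (cl a) =
  iota (cl (simple_refl i a)) * t_plus (- alpha) i.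
Proof.
rewrite !iota_cl !t_plusE /gen -!clsM.
exact/cls_rel/smash_cross.
Qed.

Lemma psi_gen_anti i a :
  psi_gen i * iota (cl a) = - (iota (cl a) * psi_gen i).
Proof.
rewrite /psi_gen -superAl -superAr -mulrA t_plus_cross mulrA -rmorphM.
by rewrite clifford_reflR rmorphN rmorphM mulNr scalerN mulrA.
Qed.

(** The substitution of [psi_gen] inverts that of [phi_gen], so the crossed
    product is an instance of the change of generators with w_i = t_i^+. *)
Lemma psi_gen_t_plus i :
  t_plus (- alpha) i = - 'i *: (iota (cl (beta i)) * psi_gen i).
Proof.
rewrite /psi_gen -superAr scalerA mulNr -expr2 sqrCi opprK scale1r mulrA.
by rewrite -rmorphM clifford_betaK rmorph1 mul1r.
Qed.

Lemma psi_gen_relations : twisted_relations alpha psi_gen.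
Proof.
apply/(transfer_relations hW psi_gen_anti psi_gen_t_plus).
exact: twisted_gen_relations.
Qed.

Lemma psi_gen_homog i : homog true (psi_gen i).
Proof.
apply: homogZ; apply: (@homogM _ _ true false); last exact: t_plus_homog.
by apply/super_even/clifford_gen_homog.
Qed.

Definition psi : superHom (twisted alpha true) S :=
  twisted_lift psi_gen_relations psi_gen_homog.

(** Each sqrt(-1) beta_i t_i^+ anticommutes with vectors, so supercommutes with
    the whole Clifford algebra; then a homogeneous Clifford element
    supercommutes with everything that these generate. *)
Lemma psi_supercomm p q c x : homog p c -> homog q x ->
  psi x * iota c = (-1) ^+ (q && p) *: (iota c * psi x).
Proof.
move=> hc hx.
have gen_c i : iota c * psi_gen i = (-1) ^+ p *: (psi_gen i * iota c).
  rewrite (@presented_supercomm _ (clifford_pres W K) _ iota true (psi_gen i)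
    _ p c hc).
    by rewrite scalerA -signr_addb addbb scale1r.
  by move=> a; rewrite expr1 scaleN1r; apply: psi_gen_anti.
rewrite (@presented_supercomm _ (twisted_pres alpha true) _ psi p (iota c)
  _ q x hx).
  by rewrite scalerA andbC -signr_addb addbb scale1r.
move=> i; rewrite andbT.
by rewrite -[gen i]/(twisted_gen alpha true i) twisted_lift_gen.
Qed.

Definition Psi : superHom T S := tensor_lift psi_supercomm.

Lemma Psi_l c : Psi (inl_T c) = iota c.
Proof. by rewrite incl_lE tensor_liftE rmorph1 mulr1. Qed.

Lemma Psi_r x : Psi (inr_T x) = psi x.
Proof. by rewrite incl_rE tensor_liftE rmorph1 mul1r. Qed.

Lemma psi_t_odd i : psi (t_odd alpha i) = psi_gen i.
Proof. exact: twisted_lift_gen. Qed.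

Lemma PhiK : cancel Phi Psi.
Proof.
move=> x; rewrite -superHom_compE.
rewrite -[RHS]/(superHom_id S x); move: x; apply: presented_ext => -[a|i].
  by rewrite superHom_compE -iota_cl Phi_iota Psi_l.
rewrite superHom_compE -t_plusE Phi_t_plus superHomZ superHomM Psi_l Psi_r.
by rewrite psi_t_odd -psi_gen_t_plus.
Qed.

Lemma Phi_psi x : Phi (psi x) = inr_T x.
Proof.
rewrite -superHom_compE; move: x; apply: presented_ext => i.
rewrite -[gen i]/(t_odd alpha i) superHom_compE psi_t_odd /psi_gen.
rewrite superHomZ superHomM Phi_iota Phi_t_plus -superAr scalerA mulrN -expr2.
rewrite sqrCi opprK scale1r mulrA -rmorphM /= clifford_betaK rmorph1.
by rewrite mul1r.
Qed.

Lemma PsiK : cancel Psi Phi.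
Proof.
move=> x; rewrite -superHom_compE.
rewrite -[RHS]/(superHom_id T x); move: x; apply: tensor_ext => y;
  rewrite superHom_compE.
  by rewrite -incl_lE Psi_l Phi_iota.
by rewrite -incl_rE Psi_r Phi_psi.
Qed.

End Isomorphism.

Theorem theorem2p8 (R : realType) (W : weyl_type) (hW : irreducible_weyl W)
    (alpha : 'rV[R[i]]_(cocycle_rank W))
    (halpha : forall l, alpha 0 l = 1 \/ alpha 0 l = -1) :
  let iota := smash_incl_clifford (- alpha) in
  exists (Phi : superHom (smash (- alpha)) (clifford_tensor_twisted alpha))
         (Psi : superHom (clifford_tensor_twisted alpha) (smash (- alpha))),
    [/\ cancel Phi Psi /\ cancel Psi Phi,
        forall c : clifford W R[i], Phi (iota c) = tensA c 1,
        forall i : 'I_(weyl_rank W),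
          Phi (t_plus (- alpha) i)
          = - 'i *: tensA (clifford_gen (beta R[i] i)) (t_odd alpha i),
        forall c : clifford W R[i], Psi (tensA c 1) = iota c
      & forall i : 'I_(weyl_rank W),
          Psi (tensA 1 (t_odd alpha i))
          = 'i *: (iota (clifford_gen (beta R[i] i)) * t_plus (- alpha) i)].
Proof.
exists (Phi hW alpha), (Psi hW alpha); split.
- by split; [apply: PhiK | apply: PsiK].
- by move=> c; rewrite Phi_iota incl_lE.
- by move=> i; rewrite Phi_t_plus incl_lrE.
- by move=> c; rewrite -incl_lE Psi_l.
- by move=> i; rewrite -incl_rE Psi_r psi_t_odd.
Qed.
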